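(* Let $M,n,p\ge1$ be integers. Any finite-dimensional irreducible representation of the superalgebra $\mathcal W_p(M|2n)^+$ is highest weight.
   Context: Indices $a,b$ run over $1,\dots,M+2n$. Grading: $[a]=0$ for $a\le M$, $[a]=1$ for $a>M$. Put $\bar a=M+1-a$ for $a\le M$, $\bar a=2M+2n+1-a$ for $a>M$; $\theta_a=1$ for $a\le M$ and $\theta_a=\mathrm{sgn}(\frac{2M+2n+1}2-a)$ for $a>M$. The super-Yangian $Y(M|2n)$ is the associative unital $\mathbb Z_2$-graded algebra over $\mathbb C$ generated by $T^{ab}_{(r)}$, $r\ge1$, of parity $[a]+[b]$; with $T^{ab}(u)=\sum_{r\ge0}T^{ab}_{(r)}u^{-r}$, $T^{ab}_{(0)}=\delta^{ab}$, the relations are $$[T^{ab}(u),T^{cd}(v)\}=\frac{(-1)^{[c]([a]+[b])+[a][b]}}{u-v}\big(T^{cb}(u)T^{ad}(v)-T^{cb}(v)T^{ad}(u)\big)$$ ($[\cdot,\cdot\}$ the graded commutator). The twisted super-Yangian $Y(M|2n)^+$ is the subalgebra generated by the coefficients $S^{ab}_{(r)}$ of $S^{ab}(u)=\sum_{r\ge0}S^{ab}_{(r)}u^{-r}=\sum_c(-1)^{[c]([b]+1)}\theta_c\theta_bT^{ac}(u)T^{\bar b\bar c}(-u)$. Its truncation at level $p$ is its quotient by the two-sided ideal generated by all $S^{ab}_{(r)}$ with $r>p$. For representation theory, $\mathcal W_p(M|2n)^+=\mathcal W(osp(Mp|2np),[M.sl(p)]^\tau\oplus n.sl(p))$ means (its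 quantization, identified with) this quantum truncated twisted super-Yangian. Let $\Phi^+$ be the set of pairs $(a,b)$ with either $1\le a<b\le M$; or $M+1\le a<b\le M+2n$; or $1\le a\le M$ and $M+n+1\le b\le M+2n$; or $M+1\le a\le M+n$ and $1\le b\le M$. A highest weight vector is a nonzero $v$ with $S^{ab}_{(r)}v=0$ for all $(a,b)\in\Phi^+$, $r>0$, and $S^{aa}_{(r)}v\in\mathbb Cv$ for all $a$, $r>0$. An irreducible representation is highest weight if it admits a highest weight vector. *)

(* Defs.v *)
From HB Require Import structures.
From mathcomp Require Import all_boot all_algebra.
From mathcomp Require Import zify.
From mathcomp.classical Require Import boolp.
From mathcomp.reals Require Import reals.
From mathcomp.real_closed Require Import complex.
From mathcomp Require Import finmap monalg.

Set Implicit Arguments.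
Unset Strict Implicit.
Unset Printing Implicit Defensive.
Import GRing.Theory.
Local Open Scope ring_scope.
Local Open Scope quotient_scope.

Section FreeAlgebra.
Variables (K : fieldType) (X : choiceType).

Lemma malg_scalerAr (k : K) (x y : {malg K[{fmonom X}]}) :
  k *: (x * y) = x * (k *: y).
Proof.
have comm z : z * malgC k = malgC k * z :> {malg K[{fmonom X}]}.
  rewrite !malgM_def fgmulgU fgmulUg; apply: eq_bigr => m _.
  by rewrite mulm1 mul1m mulrC.
by rewrite -!mul_malgC !mulrA comm.
Qed.

(* An alias, since the library makes {malg K[_]} an algebra over K only on
   commutative monoids. *)
Definition freeAlg : Type := {malg K[{fmonom X}]}.
HB.instance Definition _ := GRing.Lalgebra.on freeAlg.
HB.instance Definition _ :=
  GRing.Lalgebra_isAlgebra.Build K freeAlg malg_scalerAr.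

Definition freeGen (x : X) : freeAlg := << fmu x >>.

End FreeAlgebra.

Section Ideal.
Variables (K : fieldType) (A : algType K) (G : A -> Prop).

(* Two-sided ideal generated by G; it is closed under scaling since
   k *: x = (k *: 1) * x. *)
Inductive in_ideal : A -> Prop :=
| ideal_gen x : G x -> in_ideal x
| ideal_0 : in_ideal 0
| ideal_sub x y : in_ideal x -> in_ideal y -> in_ideal (x - y)
| ideal_mull a x : in_ideal x -> in_ideal (a * x)
| ideal_mulr a x : in_ideal x -> in_ideal (x * a).

Definition ideal (x : A) : bool := `[< in_ideal x >].

Lemma ideal_zmod_closed : zmod_closed ideal.
Proof.
split; first by apply/asboolP; apply: ideal_0.
by move=> x y /asboolP Hx /asboolP Hy; apply/asboolP; apply: ideal_sub.
Qed.

HB.instance Definition _ :=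
  GRing.isZmodClosed.Build A ideal ideal_zmod_closed.
Definition ideal_closed := GRing.ZmodClosed.clone A ideal _.

Lemma ideal_kernel (e : {rmorphism A -> K}) :
  (forall x, G x -> e x = 0) -> forall x, in_ideal x -> e x = 0.
Proof.
move=> eG x; elim=> [y /eG //||y z _ Hy _ Hz|a y _ Hy|a y _ Hy].
- exact: rmorph0.
- by rewrite rmorphB Hy Hz subr0.
- by rewrite rmorphM Hy mulr0.
- by rewrite rmorphM Hy mul0r.
Qed.

Lemma ideal_proper (e : {rmorphism A -> K}) :
  (forall x, G x -> e x = 0) -> ~ in_ideal 1.
Proof.
by move=> eG /(ideal_kernel eG)/eqP; rewrite rmorph1 oner_eq0.
Qed.

(* The library's algebras satisfy 1 != 0, so the ideal has to be proper. *)
Definition quotAlg (_ : ~ in_ideal 1) : Type := {ideal_quot ideal_closed}.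

Variable G_proper : ~ in_ideal 1.
Local Notation Q := (quotAlg G_proper).

HB.instance Definition _ := Choice.on Q.
HB.instance Definition _ := GRing.Zmodule.on Q.

Definition qproj (x : A) : Q := \pi_({ideal_quot ideal_closed}) x.
Definition qrepr (q : Q) : A := repr (q : {ideal_quot ideal_closed}).

Lemma qreprK q : qproj (qrepr q) = q.
Proof. exact: reprK. Qed.

Lemma qproj_eq x y : reflect (qproj x = qproj y) (x - y \in ideal).
Proof. by rewrite Quotient.idealrBE; apply: (iffP eqP). Qed.

Lemma ideal_qrepr x : x - qrepr (qproj x) \in ideal.
Proof. by apply/qproj_eq; rewrite qreprK. Qed.

Lemma qprojB : {morph qproj : x y / x - y}.
Proof. by move=> x y; rewrite /qproj !piE. Qed.

Lemma qprojD : {morph qproj : x y / x + y}.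
Proof. by move=> x y; rewrite /qproj !piE. Qed.

Lemma qproj0 : qproj 0 = 0.
Proof. by rewrite -(subrr 0) qprojB subrr. Qed.

Lemma memMl a x : x \in ideal -> a * x \in ideal.
Proof. by move=> /asboolP H; apply/asboolP; apply: ideal_mull. Qed.

Lemma memMr a x : x \in ideal -> x * a \in ideal.
Proof. by move=> /asboolP H; apply/asboolP; apply: ideal_mulr. Qed.

Definition qone : Q := qproj 1.
Definition qmul (p q : Q) : Q := qproj (qrepr p * qrepr q).
Definition qscale (k : K) (q : Q) : Q := qproj (k *: qrepr q).

Lemma qprojM x y : qproj (x * y) = qmul (qproj x) (qproj y).
Proof.
apply/qproj_eq.
have -> : x * y - qrepr (qproj x) * qrepr (qproj y) =
    (x - qrepr (qproj x)) * y + qrepr (qproj x) * (y - qrepr (qproj y)).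
  by rewrite mulrBl mulrBr addrA subrK.
by apply: rpredD; [apply: memMr | apply: memMl]; apply: ideal_qrepr.
Qed.

Lemma qprojZ k x : qproj (k *: x) = qscale k (qproj x).
Proof.
apply/qproj_eq; rewrite -scalerBr -[_ - _]mul1r scalerAl.
exact/memMl/ideal_qrepr.
Qed.

Fact qmulA : associative qmul.
Proof.
move=> p q r; rewrite -(qreprK p) -(qreprK q) -(qreprK r).
by rewrite -!qprojM mulrA.
Qed.
Fact qmul1 : left_id qone qmul.
Proof. by move=> p; rewrite -(qreprK p) -qprojM mul1r. Qed.
Fact qmulr1 : right_id qone qmul.
Proof. by move=> p; rewrite -(qreprK p) -qprojM mulr1. Qed.
Fact qmulDl : left_distributive qmul +%R.
Proof.
move=> p q r; rewrite -(qreprK p) -(qreprK q) -(qreprK r).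
by rewrite -!qprojM -!qprojD -qprojM mulrDl.
Qed.
Fact qmulDr : right_distributive qmul +%R.
Proof.
move=> p q r; rewrite -(qreprK p) -(qreprK q) -(qreprK r).
by rewrite -!qprojM -!qprojD -qprojM mulrDr.
Qed.

Fact qone_neq0 : qone != 0.
Proof.
apply/eqP => H; apply: G_proper; apply/asboolP.
have /qproj_eq : qproj 1 = qproj 0 by rewrite [LHS]H qproj0.
by rewrite subr0.
Qed.

HB.instance Definition _ := GRing.Zmodule_isNzRing.Build Q
  qmulA qmul1 qmulr1 qmulDl qmulDr qone_neq0.

Fact qscaleA a b q : qscale a (qscale b q) = qscale (a * b) q.
Proof. by rewrite -(qreprK q) -!qprojZ scalerA. Qed.
Fact qscale1 : left_id 1 qscale.
Proof. by move=> q; rewrite -(qreprK q) -qprojZ scale1r. Qed.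
Fact qscaleDr : right_distributive qscale +%R.
Proof.
move=> a p q; rewrite -(qreprK p) -(qreprK q).
by rewrite -!qprojZ -!qprojD -qprojZ scalerDr.
Qed.
Fact qscaleDl q : {morph qscale^~ q : a b / a + b}.
Proof.
by move=> a b; rewrite -(qreprK q) -!qprojZ -qprojD scalerDl.
Qed.

HB.instance Definition _ := GRing.Zmodule_isLmodule.Build K Q
  qscaleA qscale1 qscaleDr qscaleDl.

Fact qscalerAl (k : K) (p q : Q) : k *: (p * q) = (k *: p) * q.
Proof.
rewrite -(qreprK p) -(qreprK q).
change (qscale k (qmul (qproj (qrepr p)) (qproj (qrepr q))) =
  qmul (qscale k (qproj (qrepr p))) (qproj (qrepr q))).
by rewrite -qprojM -!qprojZ -qprojM scalerAl.
Qed.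
Fact qscalerAr (k : K) (p q : Q) : k *: (p * q) = p * (k *: q).
Proof.
rewrite -(qreprK p) -(qreprK q).
change (qscale k (qmul (qproj (qrepr p)) (qproj (qrepr q))) =
  qmul (qproj (qrepr p)) (qscale k (qproj (qrepr q)))).
by rewrite -qprojM -!qprojZ -qprojM scalerAr.
Qed.

HB.instance Definition _ := GRing.Lmodule_isLalgebra.Build K Q qscalerAl.
HB.instance Definition _ := GRing.Lalgebra_isAlgebra.Build K Q qscalerAr.

Lemma quotAlg_lift (e : {rmorphism A -> K}) : (forall x, G x -> e x = 0) ->
  exists e' : {rmorphism Q -> K}, forall x, e' (qproj x) = e x.
Proof.
move=> eG; pose f (q : Q) := e (qrepr q).
have fE x : f (qproj x) = e x.
  apply/esym/eqP; rewrite -subr_eq0 -rmorphB; apply/eqP.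
  exact/(ideal_kernel eG)/asboolP/ideal_qrepr.
have fB : zmod_morphism f.
  move=> p q; rewrite -(qreprK p) -(qreprK q) -qprojB !fE.
  exact: rmorphB.
have fM : monoid_morphism f.
  split; first by rewrite [LHS](fE 1) rmorph1.
  move=> p q; rewrite -(qreprK p) -(qreprK q).
  by rewrite [X in f X](esym (qprojM _ _)) !fE rmorphM.
pose mB := GRing.isZmodMorphism.Build _ _ f fB.
pose mM := GRing.isMonoidMorphism.Build _ _ f fM.
pose F : {rmorphism Q -> K} := HB.pack f mB mM.
by exists F.
Qed.

End Ideal.

Section Subalgebra.
Variables (K : fieldType) (A : algType K) (G : A -> Prop).

Inductive in_subalg : A -> Prop :=
| subalg_gen x : G x -> in_subalg x
| subalg_1 : in_subalg 1
| subalg_sub x y : in_subalg x -> in_subalg y -> in_subalg (x - y)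
| subalg_mul x y : in_subalg x -> in_subalg y -> in_subalg (x * y)
| subalg_scale k x : in_subalg x -> in_subalg (k *: x).

Definition subalg (x : A) : bool := `[< in_subalg x >].

Lemma subalg_subring_closed : subring_closed subalg.
Proof.
split; first by apply/asboolP; apply: subalg_1.
- by move=> x y /asboolP Hx /asboolP Hy; apply/asboolP; apply: subalg_sub.
- by move=> x y /asboolP Hx /asboolP Hy; apply/asboolP; apply: subalg_mul.
Qed.

HB.instance Definition _ :=
  GRing.isSubringClosed.Build A subalg subalg_subring_closed.

Lemma subalg_scaler_closed : scaler_closed subalg.
Proof. by move=> k x /asboolP Hx; apply/asboolP; apply: subalg_scale. Qed.

HB.instance Definition _ :=
  GRing.isScaleClosed.Build K A subalg subalg_scaler_closed.

Definition subAlg : Type := {x : A | subalg x}.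
HB.instance Definition _ := SubChoice.on subAlg.
HB.instance Definition _ := [SubChoice_isSubAlgebra of subAlg by <:].

Definition subGen (x : A) (Gx : G x) : subAlg :=
  exist _ x (asboolT (subalg_gen Gx)).

End Subalgebra.

Section SuperRepresentations.
Variables (K : fieldType) (A : algType K).
(* [gr e x]: x is homogeneous of parity e *)
Variables (gr : bool -> A -> Prop) (V : vectType K).

Record superrep := Superrep {
  rep_act :> {linear A -> 'End(V)};
  rep_act1 : rep_act 1 = \1%VF;
  rep_actM : forall x y, rep_act (x * y) = (rep_act x \o rep_act y)%VF;
  vpart : bool -> {vspace V};
  vpart_full : (vpart false + vpart true)%VS = fullv;
  vpart_direct : (vpart false :&: vpart true)%VS = 0%VS;
  rep_graded : forall e d x v,
    gr e x -> v \in vpart d -> rep_act x v \in vpart (e (+) d)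
}.

Definition is_subrep (rho : superrep) (U : {vspace V}) : Prop :=
  U = ((U :&: vpart rho false) + (U :&: vpart rho true))%VS /\
  forall x : A, (rho x @: U <= U)%VS.

Definition irreducible_rep (rho : superrep) : Prop :=
  (fullv : {vspace V}) <> 0%VS /\
  forall U, is_subrep rho U -> U = 0%VS \/ U = fullv.

End SuperRepresentations.

(* Formal power series in u^-1, as sequences of coefficients. *)
Section Series.
Variable A : pzRingType.
Implicit Types f g : nat -> A.

Definition series_mul f g : nat -> A :=
  fun r => \sum_(k < r.+1) f k * g (r - k)%N.
(* f(-u) *)
Definition series_negu f : nat -> A := fun r => (-1) ^+ r * f r.

End Series.

Section Yangian.
Variables (K : fieldType) (M n : nat).

Definition idx := 'I_(M + 2 * n).

(* Ordinals start at 0; [pos a] is the index in 1, ..., M + 2n. *)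
Definition pos (a : idx) : nat := a.+1.

Definition par (a : idx) : bool := (M < pos a)%N.

Lemma bar_subproof (a : idx) :
  ((if pos a <= M then M + 1 - pos a else 2 * M + 2 * n + 1 - pos a).-1
     < M + 2 * n)%N.
Proof. by case: a => a /= Ha; rewrite /pos /=; case: ifP; lia. Qed.

Definition bar (a : idx) : idx := Ordinal (bar_subproof a).

Definition theta (a : idx) : int :=
  if (pos a <= M)%N then 1
  else Num.sg ((2 * M + 2 * n + 1)%N%:Z - (2 * pos a)%N%:Z).

(* (a, b, r) stands for the generator T^{ab}_(r+1). *)
Definition Tlabel := (idx * idx * nat)%type.

Definition Tfree (a b : idx) (r : nat) : freeAlg K Tlabel :=
  if r is r'.+1 then freeGen K (a, b, r') else (a == b)%:R.

(* Graded commutator of x and y homogeneous of parities i and j. *)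
Definition gcomm (A : pzRingType) (i j : bool) (x y : A) : A :=
  x * y - (-1) ^+ (i * j)%N * (y * x).

(* Coefficient of u^-r v^-s in the defining relation multiplied by u - v, for
   a family t of would-be generators. The remaining coefficients, at u^1 v^-s
   and u^-r v^1, are graded commutators with the scalars T_(0), hence vanish
   identically. *)
Definition yangian_rel (A : pzRingType) (t : idx -> idx -> nat -> A)
    (a b c d : idx) (r s : nat) : A :=
  let br r s := gcomm (par a (+) par b) (par c (+) par d)
                  (t a b r) (t c d s) in
  (br r.+1 s - br r s.+1) -
  (-1) ^+ (par c * (par a + par b) + par a * par b)%N *
    (t c b r * t a d s - t c b s * t a d r).

Definition Sseries (A : pzRingType) (t : idx -> idx -> nat -> A)
    (a b : idx) (r : nat) : A :=
  \sum_(c : idx)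
    (-1) ^+ (par c * (par b + 1))%N * (theta c * theta b)%:~R *
    series_mul (t a c) (series_negu (t (bar b) (bar c))) r.

Section Counit.
Variables (A : pzRingType) (e : {rmorphism A -> K}).
Variable t : idx -> idx -> nat -> A.
Hypothesis et : forall a b r, e (t a b r) = ((r == 0%N) && (a == b))%:R.

Lemma counit_yangian_rel a b c d r s : e (yangian_rel t a b c d r s) = 0.
Proof.
have br r' s' : e (gcomm (par a (+) par b) (par c (+) par d)
    (t a b r') (t c d s')) = 0.
  rewrite rmorphB !rmorphM rmorphXn rmorphN1 !et.
  case: (eqVneq a b) => [->|_]; last by rewrite andbF !(mul0r, mulr0) subrr.
  by rewrite addbb mul0n expr0 mul1r mulrC subrr.
rewrite /yangian_rel 2!rmorphB !br subrr sub0r; apply/eqP; rewrite oppr_eq0.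
rewrite rmorphM rmorphB !rmorphM !et mulf_eq0; apply/orP; right.
by case: r s => [|r] [|s] /=; rewrite ?(mul0r, mulr0) ?subrr.
Qed.

Lemma counit_Sseries a b r : e (Sseries t a b r.+1) = 0.
Proof.
rewrite rmorph_sum big1 // => c _; rewrite rmorphM; apply/eqP.
rewrite mulf_eq0; apply/orP; right; apply/eqP.
rewrite rmorph_sum big1 // => k _; rewrite rmorphM et.
case: k => [[|k] Hk] /=; last by rewrite mul0r.
by rewrite /series_negu rmorphM subn0 et /= !mulr0.
Qed.

End Counit.

Definition yangian_rels (x : freeAlg K Tlabel) : Prop :=
  exists a b c d r s, x = yangian_rel Tfree a b c d r s.

(* The counit T(u) |-> 1 shows that the ideal of relations is proper. *)
Definition counit_free (x : freeAlg K Tlabel) : K :=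
  mcoeff (@mone {fmonom Tlabel}) x.
Fact counit_free_zmod : zmod_morphism counit_free.
Proof. by move=> x y; exact: (@mcoeffB _ _ mone x y). Qed.
Fact counit_free_monoid : monoid_morphism counit_free.
Proof.
have [cM c1] := @mcoeff1g_is_multiplicative {fmonom Tlabel} K.
by split; [exact: c1 | exact: cM].
Qed.
HB.instance Definition _ := GRing.isZmodMorphism.Build _ _ counit_free
  counit_free_zmod.
HB.instance Definition _ := GRing.isMonoidMorphism.Build _ _ counit_free
  counit_free_monoid.

Lemma counit_Tfree a b r :
  counit_free (Tfree a b r) = ((r == 0%N) && (a == b))%:R.
Proof.
case: r => [|r] /=; first by rewrite rmorph_nat.
by rewrite /counit_free /freeGen mcoeffU1 fmP fmU fm1.
Qed.

Lemma counit_rels x : yangian_rels x -> counit_free x = 0.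
Proof.
by move=> [a [b [c [d [r [s ->]]]]]]; apply: counit_yangian_rel counit_Tfree _ _ _ _ _ _.
Qed.

Lemma yangian_proper : ~ in_ideal yangian_rels 1.
Proof. exact: ideal_proper counit_rels. Qed.

Definition superYangian : algType K := quotAlg yangian_proper.

Definition Tcoef (a b : idx) (r : nat) : superYangian :=
  qproj yangian_proper (Tfree a b r).

Definition word_par (w : {fmonom Tlabel}) : bool :=
  \big[addb/false]_(g <- (w : seq Tlabel)) (par g.1.1 (+) par g.1.2).

Definition superYangian_par (e : bool) (y : superYangian) : Prop :=
  exists2 f : {malg K[{fmonom Tlabel}]},
    (forall w, f@_w != 0 -> word_par w = e) & y = qproj yangian_proper f.

Definition Sser : idx -> idx -> nat -> superYangian := Sseries Tcoef.

Definition Sgens (y : superYangian) : Prop := exists a b r, y = Sser a b r.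

Definition twistedYangian : algType K := subAlg Sgens.

Definition Stw (a b : idx) (r : nat) : twistedYangian :=
  @subGen _ _ Sgens (Sser a b r)
    (ex_intro _ a (ex_intro _ b (ex_intro _ r erefl))).

Definition twistedYangian_par (e : bool) (y : twistedYangian) : Prop :=
  superYangian_par e (\val (y : subAlg Sgens)).

Definition trunc_rels (p : nat) (y : twistedYangian) : Prop :=
  exists a b r, (p < r)%N /\ y = Stw a b r.

Lemma trunc_proper p : ~ in_ideal (trunc_rels p) 1.
Proof.
have [e eE] := quotAlg_lift yangian_proper counit_rels.
have eT a b r : e (Tcoef a b r) = ((r == 0%N) && (a == b))%:R.
  exact: etrans (eE _) (counit_Tfree _ _ _).
have eS a b r : e (Sser a b r.+1) = 0 by apply: counit_Sseries.
have [e' e'E] : exists e' : {rmorphism subAlg Sgens -> K},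
    forall y : subAlg Sgens, e' y = e (\val y).
  by exists (e \o (\val : subAlg Sgens -> superYangian)).
apply: (@ideal_proper _ _ _ e') => _ [a [b [[|r] [//= _ ->]]]].
by rewrite [LHS]e'E eS.
Qed.

Definition Walg (p : nat) : algType K := quotAlg (@trunc_proper p).

Definition Scoef (p : nat) (a b : idx) (r : nat) : Walg p :=
  qproj (@trunc_proper p) (Stw a b r).

Definition Walg_par (p : nat) (e : bool) (x : Walg p) : Prop :=
  exists2 y, twistedYangian_par e y & x = qproj (@trunc_proper p) y.

Definition Wrep (p : nat) (V : vectType K) := superrep (@Walg_par p) V.

Definition Phi_plus (a b : idx) : bool :=
  let a := pos a in let b := pos b in
  [|| [&& 1 <= a, a < b & b <= M],
      [&& M + 1 <= a, a < b & b <= M + 2 * n],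
      [&& 1 <= a, a <= M, M + n + 1 <= b & b <= M + 2 * n]
    | [&& M + 1 <= a, a <= M + n, 1 <= b & b <= M]]%N.

Definition is_highest_weight_vector (p : nat) (V : vectType K)
    (rho : Wrep p V) (v : V) : Prop :=
  [/\ v != 0,
      forall a b r, Phi_plus a b -> (0 < r)%N -> rho (Scoef p a b r) v = 0
    & forall a r, (0 < r)%N -> exists l : K, rho (Scoef p a a r) v = l *: v].

Definition is_highest_weight (p : nat) (V : vectType K) (rho : Wrep p V) :=
  exists v : V, is_highest_weight_vector rho v.

End Yangian.

(* Main.v *)
Require Import Defs.
From HB Require Import structures.
From mathcomp Require Import all_boot all_order all_algebra.
From mathcomp Require Import zify.
From mathcomp.classical Require Import boolp.
From mathcomp.reals Require Import reals.
From mathcomp.real_closed Require Import complex.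
Set Implicit Arguments.
Unset Strict Implicit.
Unset Printing Implicit Defensive.
Import GRing.Theory.
Local Open Scope ring_scope.

(** The highest weight vector is found among the vectors of maximal weight for
    one well-chosen element [h] of the Cartan subalgebra of osp(M|2n).

    Give the indices weights [weight a] in such a way that
    [weight (bar a) = - weight a], that distinct indices have distinct weights,
    and that [Phi_plus a b] implies [weight b < weight a].  Then the element
    [h], twice the sum of the [weight a * (-1)^par a * T^aa_1], lies in the
    twisted Yangian, and [S^ab_r] is an eigenvector of [ad h] of eigenvalue
    [2 * (weight a - weight b)] ([weight_S]).  Choose an eigenvalue [l] of [h]
    on [V] of maximal real part ([top_eigenvalue]) and let [U] be its
    eigenspace.  For [Phi_plus a b] the operator [S^ab_r] would raise the
    eigenvalue, so it kills [U] ([act_raising]); as [S^aa_r] commutes with [h],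
    it preserves [U].  It remains to find a common eigenvector of the [S^aa_r]
    in [U].

    For this it is enough that those [S^aa_r] with [weight a <= 0] commute on
    [U] ([act_comm]).  First, the symmetry relation ([S_symmetry]) writes
    [S^(bar a)(bar a)_(r+1)] as a combination of [S^aa_(r+1)] and [S^aa_r], so
    one index of each pair [a, bar a] suffices.  Secondly, pairwise commuting
    operators have a common eigenvector over an algebraically closed field
    ([simultaneous_eigenvector]).

    The commutation comes from the reflection equation
      [R(u-v) S_1(u) R'(u+v) S_2(v) = S_2(v) R'(u+v) S_1(u) R(u-v)].
    Its diagonal coefficient at [(a, c)] contains the commutator of
    [S^aa(u)] and [S^cc(v)] and other products of two entries of [S].  When
    [weight c < weight a <= 0], each of those has a right factor [S^pq] with
    [weight q < weight p], which kills [U]; the same holds, up to multiples of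
    the commutator itself, when [a = c].  What is left is a product of the
    commutator with power series that can be cancelled ([cancel_R],
    [cancel_R']).

    The reflection equation is derived as usual from the RTT relation: writing
    [S(u) = T(u) T'(u)], with [T'] the twisted transpose at [-u], one moves
    factors past each other with the RTT relation and its three transposed
    forms ([RTT], [RTT'], [TRT], [TRT']).  All signs of the super setting are
    put in the action of [T_1] ([op1]) and in the coefficients of [T'], [P] and
    [Q], after which these are identities between ordinary operators. *)

(** * Formal power series with noncommutative coefficients *)

(** A copy of the function space, so that it can carry the convolution
    product. *)
Definition fps (A : Type) : Type := nat -> A.
HB.instance Definition _ (A : Type) := gen_eqMixin (fps A).
HB.instance Definition _ (A : Type) := gen_choiceMixin (fps A).

Section FpsZmodule.
Variable A : zmodType.
Implicit Types f g : fps A.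

Definition fps_add f g : fps A := fun r => f r + g r.
Definition fps_opp f : fps A := fun r => - f r.
Definition fps_zero : fps A := fun=> 0.

Fact fps_addA : associative fps_add.
Proof. by move=> f g h; apply/funext => r; rewrite /fps_add addrA. Qed.
Fact fps_addC : commutative fps_add.
Proof. by move=> f g; apply/funext => r; rewrite /fps_add addrC. Qed.
Fact fps_add0 : left_id fps_zero fps_add.
Proof. by move=> f; apply/funext => r; rewrite /fps_add add0r. Qed.
Fact fps_addN : left_inverse fps_zero fps_opp fps_add.
Proof. by move=> f; apply/funext => r; rewrite /fps_add addNr. Qed.

HB.instance Definition _ := GRing.isZmodule.Build (fps A)
  fps_addA fps_addC fps_add0 fps_addN.

Lemma coefsD f g r : (f + g) r = f r + g r. Proof. by []. Qed.
Lemma coefsN f r : (- f) r = - f r. Proof. by []. Qed.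
Lemma coefsB f g r : (f - g) r = f r - g r. Proof. by []. Qed.
Lemma coefs0 r : (0 : fps A) r = 0. Proof. by []. Qed.
Lemma coefs_sum (I : Type) (s : seq I) (P : pred I) (F : I -> fps A) r :
  (\sum_(i <- s | P i) F i) r = \sum_(i <- s | P i) F i r.
Proof. exact: (big_morph (fun f : fps A => f r)). Qed.

(** Multiplication by the variable. *)
Definition shift f : fps A := fun r => if r is r'.+1 then f r' else 0.

Fact shift_zmod_morphism : zmod_morphism shift.
Proof. by move=> f g; apply/funext => -[|r] //=; rewrite [RHS]subrr. Qed.
HB.instance Definition _ :=
  GRing.isZmodMorphism.Build _ _ shift shift_zmod_morphism.

Lemma shift_inj : injective shift.
Proof.
move=> f g fg; apply/funext => r.
by move: (congr1 (fun h : fps A => h r.+1) fg).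
Qed.

End FpsZmodule.

Section FpsRing.
Variable A : nzRingType.
Implicit Types f g h : fps A.

Definition fps_mul f g : fps A := series_mul f g.
Definition fps_one : fps A := fun r => (r == 0%N)%:R.

(** Low coefficients only see truncations; this transfers the associativity of
    the product of polynomials. *)
Lemma fps_mul_poly n f g r : (r <= n)%N ->
  fps_mul f g r = ((\poly_(i < n.+1) f i) * (\poly_(i < n.+1) g i))`_r.
Proof.
move=> lerr; rewrite coefM; apply: eq_bigr => k _; rewrite !coef_poly.
by rewrite !ltnS (leq_trans _ lerr) ?(leq_trans (leq_subr _ _) lerr) // -ltnS.
Qed.

Fact fps_mulA : associative fps_mul.
Proof.
move=> f g h; apply/funext => r.
transitivity ((\poly_(i < r.+1) f i *
   (\poly_(i < r.+1) g i * \poly_(i < r.+1) h i))`_r).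
  rewrite coefM; apply: eq_bigr => k _.
  by rewrite coef_poly ltn_ord (fps_mul_poly _ _ (leq_subr k r)).
rewrite mulrA coefM; apply: eq_bigr => k _.
by rewrite coef_poly ltnS leq_subr -fps_mul_poly // -ltnS.
Qed.
Fact fps_mul1 : left_id fps_one fps_mul.
Proof.
move=> f; apply/funext => r; rewrite /fps_mul /series_mul big_ord_recl /=.
by rewrite mul1r subn0 big1 ?addr0 // => i _; rewrite mul0r.
Qed.
Fact fps_mulr1 : right_id fps_one fps_mul.
Proof.
move=> f; apply/funext => r; rewrite /fps_mul /series_mul big_ord_recr /=.
rewrite subnn mulr1 big1 ?add0r // => i _; rewrite /fps_one subn_eq0.
by rewrite leqNgt ltn_ord mulr0.
Qed.
Fact fps_mulDl : left_distributive fps_mul +%R.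
Proof.
move=> f g h; apply/funext => r; rewrite coefsD -big_split.
by apply: eq_bigr => k _; rewrite coefsD mulrDl.
Qed.
Fact fps_mulDr : right_distributive fps_mul +%R.
Proof.
move=> f g h; apply/funext => r; rewrite coefsD -big_split.
by apply: eq_bigr => k _; rewrite coefsD mulrDr.
Qed.
Fact fps_one_neq0 : fps_one != 0.
Proof.
by apply/eqP => /(congr1 (fun f : fps A => f 0%N))/eqP; rewrite oner_eq0.
Qed.

HB.instance Definition _ := GRing.Zmodule_isNzRing.Build (fps A)
  fps_mulA fps_mul1 fps_mulr1 fps_mulDl fps_mulDr fps_one_neq0.

Lemma coefsM f g r : (f * g) r = \sum_(k < r.+1) f k * g (r - k)%N.
Proof. by []. Qed.
Lemma coefs1 r : (1 : fps A) r = (r == 0%N)%:R. Proof. by []. Qed.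

Lemma shiftMl f g : shift f * g = shift (f * g).
Proof.
apply/funext => -[|r]; first by rewrite coefsM big_ord_recl big_ord0 mul0r addr0.
by rewrite coefsM big_ord_recl mul0r add0r.
Qed.

Lemma shiftMr f g : f * shift g = shift (f * g).
Proof.
apply/funext => -[|r]; first by rewrite coefsM big_ord_recl big_ord0 mulr0 addr0.
rewrite coefsM big_ord_recr /= subnn mulr0 addr0 coefsM; apply: eq_bigr => k _.
by rewrite subSn // -ltnS.
Qed.

Definition fps_const (a : A) : fps A := fun r => if r == 0%N then a else 0.

Fact fps_const_zmod_morphism : zmod_morphism fps_const.
Proof.
move=> a b; apply/funext => r; rewrite coefsB /fps_const.
by case: eqP; rewrite ?subr0.
Qed.
Lemma coefs_constM a f r : (fps_const a * f) r = a * f r.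
Proof.
rewrite coefsM big_ord_recl /= subn0 big1 ?addr0 // => i _.
by rewrite /fps_const /= mul0r.
Qed.
Lemma coefs_Mconst a f r : (f * fps_const a) r = f r * a.
Proof.
rewrite coefsM big_ord_recr /= subnn big1 ?add0r // => i _.
by rewrite /fps_const subn_eq0 leqNgt ltn_ord mulr0.
Qed.
Fact fps_const_monoid_morphism : monoid_morphism fps_const.
Proof.
split; first by apply/funext => r; rewrite coefs1 /fps_const; case: eqP.
move=> a b; apply/funext => r; rewrite coefs_constM /fps_const.
by case: eqP; rewrite ?mulr0.
Qed.
HB.instance Definition _ :=
  GRing.isZmodMorphism.Build _ _ fps_const fps_const_zmod_morphism.
HB.instance Definition _ :=
  GRing.isMonoidMorphism.Build _ _ fps_const fps_const_monoid_morphism.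

(** f(-u) *)
Definition fps_negu f : fps A := series_negu f.
Fact fps_negu_zmod_morphism : zmod_morphism fps_negu.
Proof. by move=> f g; apply/funext => r; rewrite coefsB -mulrBr. Qed.
Fact fps_negu_monoid_morphism : monoid_morphism fps_negu.
Proof.
split.
  apply/funext => r; rewrite coefs1 /fps_negu /series_negu coefs1.
  by case: eqP => [->|_]; rewrite ?mulr0 // mulr1.
move=> f g; apply/funext => r; rewrite /fps_negu /series_negu !coefsM mulr_sumr.
apply: eq_bigr => k _; have ler : (k <= r)%N by rewrite -ltnS.
rewrite -{1}(subnKC ler) exprD -!mulrA; congr (_ * _).
by rewrite !mulrA (commr_sign (f k)).
Qed.
HB.instance Definition _ :=
  GRing.isZmodMorphism.Build _ _ fps_negu fps_negu_zmod_morphism.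
HB.instance Definition _ :=
  GRing.isMonoidMorphism.Build _ _ fps_negu fps_negu_monoid_morphism.

Lemma fps_neguK : involutive fps_negu.
Proof.
by move=> f; apply/funext => r; rewrite /fps_negu /series_negu signrMK.
Qed.

End FpsRing.

Section FpsMap.
Variables (A B : nzRingType) (f : {rmorphism A -> B}).

Definition fps_map (s : fps A) : fps B := fun r => f (s r).
Fact fps_map_zmod_morphism : zmod_morphism fps_map.
Proof. by move=> s t; apply/funext => r; rewrite coefsB -rmorphB. Qed.
Fact fps_map_monoid_morphism : monoid_morphism fps_map.
Proof.
split; first by apply/funext => r; rewrite /fps_map !coefs1 rmorph_nat.
move=> s t; apply/funext => r; rewrite /fps_map !coefsM rmorph_sum.
by apply: eq_bigr => k _; rewrite rmorphM.
Qed.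
HB.instance Definition _ :=
  GRing.isZmodMorphism.Build _ _ fps_map fps_map_zmod_morphism.
HB.instance Definition _ :=
  GRing.isMonoidMorphism.Build _ _ fps_map fps_map_monoid_morphism.
End FpsMap.

(** ** Two variables *)

(** In [fps (fps A)] the outer variable is x = u^-1 and the inner one is
    y = v^-1.  Both are central; they enter through [mulX] and [mulY], which
    make sense for coefficients in a mere abelian group, so that relations can
    be applied to a vector of a representation. *)
Section ShiftTwoVariables.
Variable A : zmodType.
Implicit Type F : fps (fps A).

Definition mulX F : fps (fps A) := shift F.
Definition mulY F : fps (fps A) := fun r => shift (F r).
Fact mulX_zmod_morphism : zmod_morphism mulX.
Proof. exact: raddfB. Qed.
HB.instance Definition _ :=
  GRing.isZmodMorphism.Build _ _ mulX mulX_zmod_morphism.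
Fact mulY_zmod_morphism : zmod_morphism mulY.
Proof. by move=> F G; apply/funext => r; rewrite /mulY coefsB raddfB. Qed.
HB.instance Definition _ :=
  GRing.isZmodMorphism.Build _ _ mulY mulY_zmod_morphism.

Lemma mulYX F : mulY (mulX F) = mulX (mulY F).
Proof. by apply/funext => -[|r] //; rewrite /mulY /= raddf0. Qed.

End ShiftTwoVariables.
Arguments mulX : simpl never.
Arguments mulY : simpl never.

Section MapTwoVariables.
Variables (A A' : zmodType) (f : {additive A -> A'}).

Definition map2 (F : fps (fps A)) : fps (fps A') := fun i j => f (F i j).
Fact map2_zmod_morphism : zmod_morphism map2.
Proof.
by move=> F G; apply/funext => i; apply/funext => j; rewrite /map2 /= raddfB.
Qed.
HB.instance Definition _ :=
  GRing.isZmodMorphism.Build _ _ map2 map2_zmod_morphism.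

Lemma map2X F : map2 (mulX F) = mulX (map2 F).
Proof.
by apply/funext => -[|i]; apply/funext => j //; rewrite /map2 /mulX /= raddf0.
Qed.
Lemma map2Y F : map2 (mulY F) = mulY (map2 F).
Proof.
by apply/funext => i; apply/funext => -[|j] //; rewrite /map2 /mulY /= raddf0.
Qed.
End MapTwoVariables.

Section TwoVariables.
Variable A : nzRingType.
Implicit Types (f g : fps A) (F G : fps (fps A)).

Definition inX : {rmorphism fps A -> fps (fps A)} := fps_map (@fps_const A).
Definition inY : {rmorphism fps A -> fps (fps A)} := @fps_const (fps A).

Lemma mulXMl F G : mulX F * G = mulX (F * G). Proof. exact: shiftMl. Qed.
Lemma mulXMr F G : F * mulX G = mulX (F * G). Proof. exact: shiftMr. Qed.
Lemma mulYMl F G : mulY F * G = mulY (F * G).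
Proof.
apply/funext => r; rewrite /mulY !coefsM raddf_sum.
by apply: eq_bigr => k _; rewrite shiftMl.
Qed.
Lemma mulYMr F G : F * mulY G = mulY (F * G).
Proof.
apply/funext => r; rewrite /mulY !coefsM raddf_sum.
by apply: eq_bigr => k _; rewrite shiftMr.
Qed.
Lemma coefsXY f g i j : (inX f * inY g) i j = f i * g j.
Proof. by rewrite coefs_Mconst coefs_constM. Qed.
Lemma coefsYX f g i j : (inY g * inX f) i j = g j * f i.
Proof. by rewrite coefs_constM coefs_Mconst. Qed.

End TwoVariables.

(** * Signs and the index involution *)

Section Signs.

(** Multiplication by (-1)^b.  Keeping the exponent as a boolean reduces the
    comparison of signs to a truth table, and no scalars are needed. *)
Definition sg (A : zmodType) (b : bool) (x : A) : A := if b then - x else x.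

Fact sg_zmod_morphism (A : zmodType) b : zmod_morphism (@sg A b).
Proof. by case: b => x y //=; rewrite opprB opprK addrC. Qed.
HB.instance Definition _ (A : zmodType) b :=
  GRing.isZmodMorphism.Build _ _ (@sg A b) (@sg_zmod_morphism A b).

Lemma sg_sg (A : zmodType) b c (x : A) : sg b (sg c x) = sg (b (+) c) x.
Proof. by case: b c => -[] //=; rewrite opprK. Qed.
Lemma raddf_sg (A A' : zmodType) (f : {additive A -> A'}) b x :
  f (sg b x) = sg b (f x).
Proof. by case: b; rewrite //= raddfN. Qed.
Lemma sgMl (A : pzRingType) b (x y : A) : sg b x * y = sg b (x * y).
Proof. by case: b; rewrite //= mulNr. Qed.
Lemma sgMr (A : pzRingType) b (x y : A) : x * sg b y = sg b (x * y).
Proof. by case: b; rewrite //= mulrN. Qed.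
Lemma sgE (A : pzRingType) b (x : A) : sg b x = (-1) ^+ b * x.
Proof. by rewrite mulr_sign. Qed.
Lemma sg_sum (A : zmodType) b (I : Type) (r : seq I) (P : pred I) (F : I -> A) :
  sg b (\sum_(i <- r | P i) F i) = \sum_(i <- r | P i) sg b (F i).
Proof. exact: raddf_sum. Qed.
Lemma sg0 (A : zmodType) b : sg b (0 : A) = 0.
Proof. exact: raddf0. Qed.
Lemma sgB (A : zmodType) b (x y : A) : sg b (x - y) = sg b x - sg b y.
Proof. exact: raddfB. Qed.
Lemma sgD (A : zmodType) b (x y : A) : sg b (x + y) = sg b x + sg b y.
Proof. exact: raddfD. Qed.
Lemma sgN (A : zmodType) b (x : A) : sg b (- x) = - sg b x.
Proof. exact: raddfN. Qed.
Lemma sgB_opp (A : zmodType) b c (x y : A) :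
  sg b x - sg c y = sg (~~ c) y - sg (~~ b) x.
Proof. by rewrite -!addbT -!sg_sg !sgN opprK addrC. Qed.
Lemma eq_sg (A : zmodType) b c (x : A) : b = c -> sg b x = sg c x.
Proof. by move=> ->. Qed.
End Signs.
Arguments sg : simpl never.

Lemma coefs_sg (A : zmodType) b (f : fps A) r : (sg b f) r = sg b (f r).
Proof. by case: b. Qed.

(** The sign exponent of [theta], see [theta_sign]. *)
Definition odd_theta M n (a : idx M n) : bool := (M + n < pos a)%N.

(** Decides an identity between sign exponents by cases on all parities. *)
Ltac parity_cases :=
  repeat match goal with
  | |- context [par ?a] => case: (par a)
  | |- context [odd_theta ?a] => case: (odd_theta a)
  | |- context [odd ?k] => case: (odd k)
  | b : bool |- context [?b'] => constr_eq b b'; case: (b)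
  end; try by [].

Section Indices.
Variables M n : nat.
Implicit Types a b : idx M n.

Lemma theta_sign a : theta a = (-1) ^+ odd_theta a.
Proof.
rewrite /theta /odd_theta; case: (leqP (pos a) M) => aM.
  by have -> : (M + n < pos a)%N = false by lia.
case: ltnP => aMn; rewrite ?expr1 ?expr0.
  by apply: Num.Theory.ltr0_sg; lia.
by apply: Num.Theory.gtr0_sg; lia.
Qed.

Lemma pos_bar a : pos (bar a) =
  if (pos a <= M)%N then (M + 1 - pos a)%N else (2 * M + 2 * n + 1 - pos a)%N.
Proof. by case: a => a ha; rewrite /pos /= /pos /=; case: ifP => h; lia. Qed.

Lemma par_bar a : par (bar a) = par a.
Proof.
by rewrite /par pos_bar; case: a => a ha; rewrite /pos /=; case: ifP => ?; lia.
Qed.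

Lemma odd_theta_bar a : odd_theta (bar a) = par a (+) odd_theta a.
Proof.
rewrite /odd_theta /par pos_bar; case: a => a ha; rewrite /pos /=.
case: (leqP a.+1 M) => ?; case: (ltnP (M + n) a.+1) => ? //=; lia.
Qed.

Lemma pos_inj : injective (@pos M n).
Proof. by move=> a b [/val_inj]. Qed.

Lemma barK : involutive (@bar M n).
Proof.
move=> a; apply: pos_inj; rewrite !pos_bar; case: a => a ha; rewrite /pos /=.
by case: (leqP a.+1 M) => ?; case: ifP => ?; lia.
Qed.

End Indices.

(** * The reflection equation *)

Lemma add3_eq (Z : zmodType) (x1 x2 y1 y2 z1 z2 : Z) :
  (x1 - x2) + (y1 - y2) = z2 - z1 -> x1 + y1 + z1 = x2 + y2 + z2.
Proof.
move=> E; apply/eqP; rewrite -subr_eq0 opprD addrACA opprD [X in X + _]addrACA E.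
by rewrite addrA subrK subrr.
Qed.

Lemma addr_transpose3 (Z : zmodType) (x1 x2 x3 y1 y2 y3 z1 z2 z3 : Z) :
  x1 + x2 + x3 + (y1 + y2 + y3) + (z1 + z2 + z3) =
  x1 + y1 + z1 + (x2 + y2 + z2) + (x3 + y3 + z3).
Proof.
by rewrite (addrACA _ x3) (addrACA _ (x3 + y3)) (addrACA x1)
  (addrACA (x1 + y1)).
Qed.

Section Reflection.
Variables (A : nzRingType) (M n : nat).
Local Notation idx := (idx M n).
Local Notation B := (fps (fps A)).
Local Notation W := (idx -> idx -> B).
Local Notation X := (@mulX A : B -> B).
Local Notation Y := (@mulY A : B -> B).
Implicit Types (t u : idx -> idx -> B) (w : W) (a b c d : idx).

(** The R-matrix formalism acts on tensors [w] with two indices.  [op1 t] and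
    [op2 t] are the matrix [t] acting on the first and on the second factor;
    the super sign rule is carried by [op1] only.  [opP] is the graded
    permutation, [opQ] its partial twisted transpose (of rank one), and
    [opR] = (y - x) - xyP, [opR'] = (y + x) + xyQ are xy times the R-matrices
    (u - v) - P and (u + v) + Q. *)
Definition op1 t w : W := fun a c =>
  \sum_b sg ((par a (+) par b) && par c) (t a b * w b c).
Definition op2 t w : W := fun a c => \sum_d t c d * w a d.
Definition opP w : W := fun a c => sg (par a && par c) (w c a).
Definition opQ w : W := fun a c => if c == bar a then
  \sum_b sg (par a (+) odd_theta a (+) odd_theta b) (w b (bar b)) else 0.
Definition opR w : W := fun a c => Y (w a c) - X (w a c) - X (Y (opP w a c)).
Definition opR' w : W := fun a c => Y (w a c) + X (w a c) + X (Y (opQ w a c)).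

(** All compositions of the operators above have, at a fixed pair of indices,
    the form [pairing t w]; identities between operators are proved by comparing
    the coefficients [t]. *)
Definition pairing t w : B := \sum_b \sum_d t b d * w b d.

Lemma pairing_additive (f : {additive B -> B}) t w :
  (forall x y, f (x * y) = f x * y) ->
  f (pairing t w) = pairing (fun b d => f (t b d)) w.
Proof.
move=> fM; rewrite raddf_sum; apply: eq_bigr => b _; rewrite raddf_sum.
by apply: eq_bigr => d _; rewrite fM.
Qed.
Lemma pairing_sg e t w : sg e (pairing t w) = pairing (fun b d => sg e (t b d)) w.
Proof. by apply: pairing_additive => x y; rewrite sgMl. Qed.
Lemma pairingX t w : X (pairing t w) = pairing (fun b d => X (t b d)) w.
Proof. by apply: pairing_additive => x y; rewrite mulXMl. Qed.
Lemma pairingY t w : Y (pairing t w) = pairing (fun b d => Y (t b d)) w.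
Proof. by apply: pairing_additive => x y; rewrite mulYMl. Qed.
Lemma pairingB t u w :
  pairing t w - pairing u w = pairing (fun b d => t b d - u b d) w.
Proof.
rewrite -sumrB; apply: eq_bigr => b _; rewrite -sumrB.
by apply: eq_bigr => d _; rewrite mulrBl.
Qed.
Lemma pairingD t u w :
  pairing t w + pairing u w = pairing (fun b d => t b d + u b d) w.
Proof.
rewrite -big_split; apply: eq_bigr => b _; rewrite -big_split.
by apply: eq_bigr => d _; rewrite mulrDl.
Qed.
Lemma pairing_additiver (f : {additive B -> B}) t w :
  (forall x y, f (x * y) = x * f y) ->
  pairing t (fun b d => f (w b d)) = f (pairing t w).
Proof.
move=> fM; rewrite raddf_sum; apply: eq_bigr => b _; rewrite raddf_sum.
by apply: eq_bigr => d _; rewrite fM.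
Qed.
Lemma pairingXr t w : pairing t (fun b d => X (w b d)) = X (pairing t w).
Proof. by apply: pairing_additiver => x y; rewrite mulXMr. Qed.
Lemma pairingYr t w : pairing t (fun b d => Y (w b d)) = Y (pairing t w).
Proof. by apply: pairing_additiver => x y; rewrite mulYMr. Qed.
Lemma pairingBr t w w' :
  pairing t (fun b d => w b d - w' b d) = pairing t w - pairing t w'.
Proof.
rewrite -sumrB; apply: eq_bigr => b _; rewrite -sumrB.
by apply: eq_bigr => d _; rewrite mulrBr.
Qed.
Lemma pairing_opP t w :
  pairing t (opP w) = pairing (fun b d => sg (par b && par d) (t d b)) w.
Proof.
rewrite [LHS]exchange_big; apply: eq_bigr => b _; apply: eq_bigr => d _.
by rewrite /opP andbC sgMr sgMl.
Qed.
Lemma eq_pairing t u w : (forall b d, t b d = u b d) -> pairing t w = pairing u w.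
Proof.
by move=> tu; apply: eq_bigr => b _; apply: eq_bigr => d _; rewrite tu.
Qed.

Lemma op12E t u w a c : op1 t (op2 u w) a c =
  pairing (fun b d => sg ((par a (+) par b) && par c) (t a b * u c d)) w.
Proof.
apply: eq_bigr => b _; rewrite mulr_sumr sg_sum.
by apply: eq_bigr => d _; rewrite sgMl mulrA.
Qed.

Lemma op21E t u w a c : op2 u (op1 t w) a c =
  pairing (fun b d => sg ((par a (+) par b) && par d) (u c d * t a b)) w.
Proof.
rewrite [RHS]exchange_big; apply: eq_bigr => d _; rewrite mulr_sumr.
by apply: eq_bigr => b _; rewrite sgMr sgMl mulrA.
Qed.

Lemma op1Q2E t u w a c : op1 t (opQ (op2 u w)) a c =
  pairing (fun b d => sg ((par a (+) par c) && par c (+)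
     (par c (+) odd_theta (bar c) (+) odd_theta b))
     (t a (bar c) * u (bar b) d)) w.
Proof.
rewrite /op1 (bigD1 (bar c)) //= big1 ?addr0 => [|b bNc]; last first.
  rewrite /opQ; case: eqP => [cb|_]; last by rewrite mulr0 sg0.
  by case/eqP: bNc; rewrite cb barK.
rewrite /opQ barK eqxx par_bar mulr_sumr sg_sum; apply: eq_bigr => b _.
rewrite sgMr sg_sg mulr_sumr sg_sum; apply: eq_bigr => d _.
by rewrite sgMl mulrA.
Qed.

Lemma op2Q1E t u w a c : op2 u (opQ (op1 t w)) a c =
  pairing (fun b d => sg ((par a (+) odd_theta a (+) odd_theta (bar d)) (+)
     (par d (+) par b) && par d)
     (u c (bar a) * t (bar d) b)) w.
Proof.
rewrite /op2 (bigD1 (bar a)) //= big1 ?addr0 => [|b bNa]; last first.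
  by rewrite /opQ (negPf bNa) mulr0.
rewrite /opQ eqxx mulr_sumr [RHS]exchange_big.
rewrite [LHS](reindex_inj (inv_inj (@barK M n))); apply: eq_bigr => d _.
rewrite sgMr /op1 mulr_sumr sg_sum; apply: eq_bigr => b _.
by rewrite barK par_bar sgMr sg_sg mulrA sgMl.
Qed.

(** The matrix relation R t_1 u_2 = u_2 t_1 R, entry by entry. *)
Lemma op_RTT t u :
  (forall a b c d,
     let p := sg ((par a (+) par b) && par c) (t a b * u c d) -
              sg ((par a (+) par b) && par d) (u c d * t a b) in
     Y p - X p =
     X (Y (sg (par a && par c (+) (par c (+) par b) && par a)
             (t c b * u a d) -
           sg (par b && par d (+) (par a (+) par d) && par b)
             (u c b * t a d)))) ->
  forall w, opR (op1 t (op2 u w)) = op2 u (op1 t (opR w)).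
Proof.
move=> tu w; apply/funext => a; apply/funext => c.
rewrite op21E /opR /opP !op12E !pairingBr !pairingXr pairingYr.
rewrite !pairingYr pairing_opP pairing_sg.
rewrite !(pairingX, pairingY, pairingB); apply: eq_pairing => b d.
apply: add3_eq; rewrite sg_sg -opprD -!raddfB tu.
by rewrite /= sg_sg -(raddfN X) -(raddfN Y) opprB.
Qed.

Lemma op1R'2E t u w a c : op1 t (opR' (op2 u w)) a c =
  Y (op1 t (op2 u w) a c) + X (op1 t (op2 u w) a c)
  + X (Y (op1 t (opQ (op2 u w)) a c)).
Proof.
rewrite /op1 !raddf_sum -!big_split; apply: eq_bigr => b _.
by rewrite /opR' !mulrDr !sgD mulYMr !mulXMr mulYMr !raddf_sg.
Qed.

Lemma op2R'1E t u w a c : op2 u (opR' (op1 t w)) a c =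
  Y (op2 u (op1 t w) a c) + X (op2 u (op1 t w) a c)
  + X (Y (op2 u (opQ (op1 t w)) a c)).
Proof.
rewrite /op2 !raddf_sum -!big_split; apply: eq_bigr => b _.
by rewrite /opR' !mulrDr mulYMr !mulXMr mulYMr.
Qed.

(** The matrix relation t_1 R' u_2 = u_2 R' t_1, entry by entry. *)
Lemma op_RTtT t u :
  (forall a b c d,
     let p := sg ((par a (+) par b) && par c) (t a b * u c d) -
              sg ((par a (+) par b) && par d) (u c d * t a b) in
     Y p + X p =
     X (Y (sg ((par a (+) odd_theta a (+) odd_theta (bar d)) (+)
               (par d (+) par b) && par d) (u c (bar a) * t (bar d) b) -
           sg ((par a (+) par c) && par c (+)
               (par c (+) odd_theta (bar c) (+) odd_theta b))
             (t a (bar c) * u (bar b) d)))) ->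
  forall w, op1 t (opR' (op2 u w)) = op2 u (opR' (op1 t w)).
Proof.
move=> tu w; apply/funext => a; apply/funext => c.
rewrite op1R'2E op2R'1E op12E op21E op1Q2E op2Q1E.
rewrite !(pairingX, pairingY, pairingD); apply: eq_pairing => b d.
apply: add3_eq; rewrite -!raddfB tu.
by rewrite !raddfB.
Qed.

(** PQ = Q = QP: the form that defines [Q] is symmetric in the graded sense.
    This is what makes R and R' commute. *)
Lemma opP_Q w : opP (opQ w) = opQ w.
Proof.
apply/funext => a; apply/funext => c; rewrite /opP /opQ.
rewrite -(inv_eq (@barK M n)) eq_sym; case: eqP => [->|_]; last by rewrite sg0.
rewrite sg_sum; apply: eq_bigr => b _; rewrite sg_sg; congr (sg _ _).
by rewrite par_bar odd_theta_bar; parity_cases.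
Qed.

Lemma opQ_P w : opQ (opP w) = opQ w.
Proof.
apply/funext => a; apply/funext => c; rewrite /opP /opQ; case: eqP => // _.
rewrite [LHS](reindex_inj (inv_inj (@barK M n))); apply: eq_bigr => b _.
rewrite barK sg_sg; congr (sg _ _).
by rewrite par_bar odd_theta_bar; parity_cases.
Qed.

Lemma opQ_lin (f : {additive B -> B}) w a c :
  opQ (fun a c => f (w a c)) a c = f (opQ w a c).
Proof.
rewrite /opQ; case: eqP => [_|_]; last by rewrite raddf0.
by rewrite raddf_sum; apply: eq_bigr => b _; rewrite raddf_sg.
Qed.
Lemma opQB w v a c :
  opQ (fun a c => w a c - v a c) a c = opQ w a c - opQ v a c.
Proof.
rewrite /opQ; case: eqP => [_|_]; last by rewrite subr0.
by rewrite -sumrB; apply: eq_bigr => b _; rewrite sgB.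
Qed.

Lemma opR_R' w : opR (opR' w) = opR' (opR w).
Proof.
apply/funext => a; apply/funext => c.
have QX v : opQ (fun a c => X (v a c)) a c = X (opQ v a c) by exact: opQ_lin.
have QY v : opQ (fun a c => Y (v a c)) a c = Y (opQ v a c) by exact: opQ_lin.
rewrite /opR /opR' !opQB !QX QY -/(opP w) QY opQ_P /opP.
have PQ : sg (par a && par c) (opQ w c a) = opQ w a c.
  by rewrite -[RHS](congr1 (fun f : W => f a c) (opP_Q w)).
rewrite /opP !sgD -(raddf_sg Y) -(raddf_sg X) -(raddf_sg X) -(raddf_sg Y) PQ.
rewrite !(raddfD, raddfB) /= !mulYX addr_transpose3.
by rewrite !(raddfN X) !(raddfN Y) /= !mulYX !(raddfN X).
Qed.

Lemma op1_op1 t u w :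
  op1 t (op1 u w) = op1 (fun a b => \sum_c t a c * u c b) w.
Proof.
apply/funext => a; apply/funext => c; rewrite /op1.
under eq_bigr => b _.
  rewrite mulr_sumr sg_sum.
  under eq_bigr => d _ do rewrite sgMr sg_sg mulrA.
  over.
rewrite exchange_big; apply: eq_bigr => d _; rewrite mulr_suml sg_sum.
apply: eq_bigr => b _; congr (sg _ _).
by parity_cases.
Qed.

Lemma op2_op2 t u w :
  op2 t (op2 u w) = op2 (fun a b => \sum_c t a c * u c b) w.
Proof.
apply/funext => a; apply/funext => c; rewrite /op2.
under eq_bigr => b _ do rewrite mulr_sumr.
rewrite exchange_big; apply: eq_bigr => d _; rewrite mulr_suml.
by apply: eq_bigr => b _; rewrite mulrA.
Qed.

Lemma pairing_opR t w : pairing t (opR w) =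
  pairing (fun b d => Y (t b d) - X (t b d)
    - X (Y (sg (par b && par d) (t d b)))) w.
Proof.
by rewrite !pairingBr !pairingXr !pairingYr pairing_opP
  !(pairingX, pairingY, pairingB).
Qed.

(** With s = t t', in the order of the rewriting:
    R t_1 t'_1 R' t_2 t'_2 = R t_1 t_2 R' t'_1 t'_2 = t_2 t_1 R R' t'_1 t'_2
    = t_2 t_1 R' t'_2 t'_1 R = t_2 t'_2 R' t_1 t'_1 R. *)
Lemma reflection_equation tx tx' ty ty' :
  (forall w, opR (op1 tx (op2 ty w)) = op2 ty (op1 tx (opR w))) ->
  (forall w, opR (op1 tx' (op2 ty' w)) = op2 ty' (op1 tx' (opR w))) ->
  (forall w, op1 tx' (opR' (op2 ty w)) = op2 ty (opR' (op1 tx' w))) ->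
  (forall w, op1 tx (opR' (op2 ty' w)) = op2 ty' (opR' (op1 tx w))) ->
  let sx a b := \sum_c tx a c * tx' c b in
  let sy a b := \sum_c ty a c * ty' c b in
  forall w, opR (op1 sx (opR' (op2 sy w))) = op2 sy (opR' (op1 sx (opR w))).
Proof.
move=> RTT RTT' TRT TRT' sx sy w; rewrite -op1_op1 -op2_op2 TRT RTT opR_R'.
by rewrite RTT' TRT' op2_op2 op1_op1.
Qed.

Lemma pairing_delta t a c :
  pairing t (fun b d => ((b == a) && (d == c))%:R) = t a c.
Proof.
rewrite /pairing (bigD1 a) //= [X in _ + X]big1 ?addr0 => [|b bNa]; last first.
  by rewrite big1 // => d _; rewrite (negPf bNa) mulr0.
rewrite (bigD1 c) //= big1 ?addr0 => [|d dNc]; first by rewrite !eqxx mulr1.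
by rewrite (negPf dNc) andbF mulr0.
Qed.

End Reflection.

(** ** The diagonal coefficients *)

Section ReflectionDiagonal.
Variables (Z : zmodType) (M n : nat).
Local Notation idx := (idx M n).
Variables (P Q : idx -> idx -> idx -> idx -> fps (fps Z)).
Local Notation X := (@mulX Z).
Local Notation Y := (@mulY Z).
Variables (a c : idx).

(** [P a b c d] stands for S^ab(u) S^cd(v) and [Q a b c d] for S^ab(v) S^cd(u).
    They are kept abstract, with values in any abelian group, so that the same
    expression makes sense in the Yangian, in its subalgebra and on a vector.
    [refl_lhs b d] and [refl_rhs b d] are the coefficients of S_1 R' S_2 from
    (a, c) to (b, d), and of S_2 R' S_1 from (b, d) to (a, c). *)
Definition refl_lhs (b d : idx) : fps (fps Z) :=
  let G := sg ((par b (+) par a) && par d) (P b a d c) in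
  let H := sg ((par b (+) par d) && par d (+)
                (par d (+) odd_theta (bar d) (+) odd_theta a))
              (P b (bar d) (bar a) c) in
  Y G + X G + X (Y H).

Definition refl_rhs (b d : idx) : fps (fps Z) :=
  let G := sg ((par a (+) par b) && par d) (Q c d a b) in
  let H := sg ((par a (+) odd_theta a (+) odd_theta (bar d)) (+)
                (par d (+) par b) && par d)
              (Q c (bar a) (bar d) b) in
  Y G + X G + X (Y H).

(** The coefficient of R S_1 R' S_2 - S_2 R' S_1 R from (a, c) to (a, c). *)
Definition refl_diag : fps (fps Z) :=
  Y (refl_lhs a c) - X (refl_lhs a c)
  - X (Y (sg (par a && par c) (refl_lhs c a)))
  - (Y (refl_rhs a c) - X (refl_rhs a c)
     - X (Y (sg (par a && par c) (refl_rhs c a)))).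
End ReflectionDiagonal.

Lemma eq_refl_diag (Z : zmodType) M n
    (P P' Q Q' : idx M n -> idx M n -> idx M n -> idx M n -> fps (fps Z)) a c :
  (forall a b c d i j, P a b c d i j = P' a b c d i j) ->
  (forall a b c d i j, Q a b c d i j = Q' a b c d i j) ->
  refl_diag P Q a c = refl_diag P' Q' a c.
Proof.
move=> PP' QQ'; have -> : P = P' by do 6!apply/funext => ?; apply: PP'.
by have -> : Q = Q' by do 6!apply/funext => ?; apply: QQ'.
Qed.

Lemma map2_refl_diag (Z Z' : zmodType) (f : {additive Z -> Z'}) M n P Q
    (a c : idx M n) :
  map2 f (refl_diag P Q a c) =
  refl_diag (fun a b c d => map2 f (P a b c d))
            (fun a b c d => map2 f (Q a b c d)) a c.
Proof.
have fsg b F : map2 f (sg b F) = sg b (map2 f F) by rewrite raddf_sg.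
rewrite /refl_diag /refl_lhs /refl_rhs !raddfB /=.
by rewrite !(map2X, map2Y, fsg) !raddfD /= !(map2X, map2Y, fsg).
Qed.

Lemma reflection_diag (A : nzRingType) M n
    (sx sy : idx M n -> idx M n -> fps (fps A)) :
  (forall w, opR (op1 sx (opR' (op2 sy w))) = op2 sy (opR' (op1 sx (opR w)))) ->
  forall a c, refl_diag (fun a b c d => sx a b * sy c d)
                        (fun a b c d => sy a b * sx c d) a c = 0.
Proof.
move=> E a c; pose w (b d : idx M n) : fps (fps A) := ((b == a) && (d == c))%:R.
have L b d : op1 sx (opR' (op2 sy w)) b d =
    refl_lhs (fun a b c d => sx a b * sy c d) a c b d.
  rewrite op1R'2E op12E op1Q2E !(pairingX, pairingY, pairingD).
  exact: pairing_delta.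
have R : op2 sy (opR' (op1 sx (opR w))) a c =
    pairing (refl_rhs (fun a b c d => sy a b * sx c d) a c) (opR w).
  by rewrite op2R'1E op21E op2Q1E !(pairingX, pairingY, pairingD).
have := congr1 (fun f : idx M n -> idx M n -> fps (fps A) => f a c) (E w).
rewrite {}R pairing_opR pairing_delta /opR /opP !{}L => Eac.
by rewrite /refl_diag Eac subrr.
Qed.

(** * Relations of the twisted super-Yangian *)

Section YangianSeries.
Variables (A : nzRingType) (M n : nat).
Local Notation idx := (idx M n).
Local Notation X := (@mulX A : fps (fps A) -> fps (fps A)).
Local Notation Y := (@mulY A : fps (fps A) -> fps (fps A)).
Variable t : idx -> idx -> nat -> A.
Hypothesis t0 : forall a b, t a b 0%N = (a == b)%:R.
Hypothesis trel : forall a b c d r s, yangian_rel t a b c d r s = 0.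
Implicit Types a b c d : idx.

(** T^ab(u) for e = false, T^ab(-u) for e = true. *)
Definition Tpm (e : bool) a b : fps A := if e then fps_negu (t a b) else t a b.

Lemma coefs_Tpm e a b i : Tpm e a b i = sg (e && odd i) (t a b i).
Proof.
case: e => //; rewrite /Tpm /fps_negu /series_negu sgE andTb.
by rewrite -signr_odd.
Qed.

Definition Tbr a b c d i j : A :=
  t a b i * t c d j -
  sg ((par a (+) par b) && (par c (+) par d)) (t c d j * t a b i).

Lemma Tbr_rel a b c d i j : Tbr a b c d i.+1 j - Tbr a b c d i j.+1 =
  sg (par c && (par a (+) par b) (+) par a && par b)
    (t c b i * t a d j - t c b j * t a d i).
Proof.
have := trel a b c d i j; rewrite /yangian_rel /gcomm => /eqP.
rewrite subr_eq0 => /eqP; rewrite mulnb -!sgE => ->.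
rewrite sgE -signr_odd; congr (_ ^+ _ * _).
by case: (par a); case: (par b); case: (par c).
Qed.

Lemma Tbr0l a b c d j : Tbr a b c d 0 j = 0.
Proof.
rewrite /Tbr t0; case: eqP => [->|_]; last by rewrite mul0r mulr0 sg0 subr0.
by rewrite addbb mul1r mulr1 subrr.
Qed.

Lemma Tbr0r a b c d i : Tbr a b c d i 0 = 0.
Proof.
rewrite /Tbr t0; case: eqP => [->|_]; last by rewrite mul0r mulr0 sg0 subr0.
by rewrite addbb andbF mul1r mulr1 subrr.
Qed.

Definition Tx e a b := inX A (Tpm e a b).
Definition Ty e a b := inY A (Tpm e a b).

Lemma Tbr_swap a b c d i j : Tbr c d a b j i =
  - sg ((par a (+) par b) && (par c (+) par d)) (Tbr a b c d i j).
Proof. by rewrite /Tbr sgB sg_sg addbb opprB andbC. Qed.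

(** The relation for the swapped pair (c, d), (a, b): the same graded commutator,
    with the products on the right in the other order.  Both forms occur among
    the transposed RTT relations. *)
Lemma Tbr_rel' a b c d i j : Tbr a b c d i.+1 j - Tbr a b c d i j.+1 =
  sg ((par a (+) par b) && (par c (+) par d)
      (+) (par a && (par c (+) par d) (+) par c && par d))
    (t a d j * t c b i - t a d i * t c b j).
Proof.
have := Tbr_rel c d a b j i.
rewrite (Tbr_swap a b c d i j.+1) (Tbr_swap a b c d i.+1 j) => E.
rewrite -sg_sg -E.
set x := Tbr _ _ _ _ _ _; set y := Tbr _ _ _ _ _ _.
by rewrite opprK [in RHS]addrC -sgB sg_sg addbb.
Qed.

(** The relations as identities of series, uniformly in the signs of u and v.
    The coefficient T_0 is scalar, so that the boundary coefficients vanish on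
    both sides. *)
Lemma Txy_br e f g a b c d :
  let p := sg g (Tx e a b * Ty f c d) -
    sg (g (+) (par a (+) par b) && (par c (+) par d)) (Ty f c d * Tx e a b) in
  let D : fps (fps A) := fun i j => sg (e && odd i (+) f && odd j)
    (Tbr a b c d i.+1 j - Tbr a b c d i j.+1) in
  Y p - sg (e (+) f) (X p) = sg (e (+) g) (X (Y D)).
Proof.
move=> p D; have pE i j :
    p i j = sg (g (+) (e && odd i (+) f && odd j)) (Tbr a b c d i j).
  rewrite /p !coefsB !coefs_sg coefsXY coefsYX !coefs_Tpm.
  rewrite !(sgMl, sgMr, sg_sg) sgB sg_sg; congr (_ - _); apply: eq_sg.
    by parity_cases.
  by parity_cases.
apply/funext => i; apply/funext => j; rewrite !(coefsB, coefs_sg).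
rewrite /mulX /mulY; case: i j => [|i] [|j] /=;
  rewrite ?sg0 ?coefs0 ?sg0 ?subr0 ?sub0r //.
- by rewrite pE Tbr0l !sg0.
- by rewrite pE Tbr0r !sg0 oppr0.
rewrite !pE !sg_sg [RHS]sgB; congr (_ - _); apply: eq_sg => /=; parity_cases.
Qed.

Lemma Txy_rel e f g g' k k' a b c d :
  g' = g (+) (par a (+) par b) && (par c (+) par d) ->
  k = e (+) g (+) (par c && (par a (+) par b) (+) par a && par b) -> k' = k ->
  let p := sg g (Tx e a b * Ty f c d) - sg g' (Ty f c d * Tx e a b) in
  Y p - sg (e (+) f) (X p) =
  X (Y (sg k (Tx e c b * Ty f a d) - sg k' (Ty f c b * Tx e a d))).
Proof.
move=> -> {k k'}-> -> p; rewrite Txy_br -!raddf_sg; congr (X (Y _)).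
apply/funext => i; apply/funext => j.
rewrite !(coefsB, coefs_sg) Tbr_rel !sg_sg coefsXY coefsYX !coefs_Tpm.
rewrite !(sgMl, sgMr, sgB, sg_sg).
by congr (_ - _); apply: eq_sg; parity_cases.
Qed.

Lemma Txy_rel' e f g g' k k' a b c d :
  g' = g (+) (par a (+) par b) && (par c (+) par d) ->
  k = e (+) g (+) ((par a (+) par b) && (par c (+) par d)
      (+) (par a && (par c (+) par d) (+) par c && par d)) -> k' = k ->
  let p := sg g (Tx e a b * Ty f c d) - sg g' (Ty f c d * Tx e a b) in
  Y p - sg (e (+) f) (X p) =
  X (Y (sg k (Ty f a d * Tx e c b) - sg k' (Tx e a d * Ty f c b))).
Proof.
move=> -> {k k'}-> -> p; rewrite Txy_br -!raddf_sg; congr (X (Y _)).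
apply/funext => i; apply/funext => j.
rewrite !(coefsB, coefs_sg) Tbr_rel' !sg_sg coefsXY coefsYX !coefs_Tpm.
rewrite !(sgMl, sgMr, sgB, sg_sg).
by congr (_ - _); apply: eq_sg; parity_cases.
Qed.

(** The twisted transpose T' of T at -u, for which S = T T'. *)
Definition tr_sign a b := par a && ~~ par b (+) odd_theta a (+) odd_theta b.
Definition Tt a b : fps A := sg (tr_sign a b) (Tpm true (bar b) (bar a)).

Lemma inX_Tt a b : inX A (Tt a b) = sg (tr_sign a b) (Tx true (bar b) (bar a)).
Proof. exact: raddf_sg. Qed.
Lemma inY_Tt a b : inY A (Tt a b) = sg (tr_sign a b) (Ty true (bar b) (bar a)).
Proof. exact: raddf_sg. Qed.

Local Notation T1 := (Tx false).
Local Notation T2 := (Ty false).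
Local Notation T1' := (fun a b => inX A (Tt a b)).
Local Notation T2' := (fun a b => inY A (Tt a b)).

Lemma RTT w : opR (op1 T1 (op2 T2 w)) = op2 T2 (op1 T1 (opR w)).
Proof.
apply: op_RTT => a b c d p; rewrite -[X p]/(sg (false (+) false) (X p)).
by apply: Txy_rel; parity_cases.
Qed.

Lemma RTT' w : opR (op1 T1' (op2 T2' w)) = op2 T2' (op1 T1' (opR w)).
Proof.
apply: op_RTT => a b c d p; rewrite -[X p]/(sg (true (+) true) (X p)) /p.
rewrite !(inX_Tt, inY_Tt, sgMl, sgMr, sg_sg) [in RHS]sgB_opp.
by apply: Txy_rel'; rewrite /tr_sign ?(par_bar, odd_theta_bar); parity_cases.
Qed.

Lemma TRT w : op1 T1' (opR' (op2 T2 w)) = op2 T2 (opR' (op1 T1' w)).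
Proof.
apply: op_RTtT => a b c d p.
rewrite -[X p]opprK -[- X p]/(sg (true (+) false) (X p)) /p.
rewrite !(inX_Tt, inY_Tt, sgMl, sgMr, sg_sg, barK) [in RHS]sgB_opp.
by apply: Txy_rel; rewrite /tr_sign ?(par_bar, odd_theta_bar); parity_cases.
Qed.

Lemma TRT' w : op1 T1 (opR' (op2 T2' w)) = op2 T2' (opR' (op1 T1 w)).
Proof.
apply: op_RTtT => a b c d p.
rewrite -[X p]opprK -[- X p]/(sg (false (+) true) (X p)) /p.
rewrite !(inX_Tt, inY_Tt, sgMl, sgMr, sg_sg, barK).
by apply: Txy_rel'; rewrite /tr_sign ?(par_bar, odd_theta_bar); parity_cases.
Qed.

Definition Sfps a b : fps A := Sseries t a b.

Lemma SsE a b : Sfps a b = \sum_c Tpm false a c * Tt c b.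
Proof.
apply/funext => r; rewrite coefs_sum; apply: eq_bigr => c _.
rewrite /Tt sgMr coefs_sg sgE !theta_sign -signr_odd oddM oddD oddb oddb addbT.
by rewrite rmorphM !rmorphXn rmorphN1 -!signr_addb addbA.
Qed.

Lemma S_reflection a c :
  refl_diag (fun a b c d i j => Sseries t a b i * Sseries t c d j)
            (fun a b c d i j => Sseries t a b j * Sseries t c d i) a c = 0.
Proof.
have := reflection_diag (reflection_equation RTT RTT' TRT TRT') a c.
have SX a' b' : \sum_c T1 a' c * T1' c b' = inX A (Sfps a' b').
  by rewrite SsE rmorph_sum; apply: eq_bigr => e _; rewrite rmorphM.
have SY a' b' : \sum_c T2 a' c * T2' c b' = inY A (Sfps a' b').
  by rewrite SsE rmorph_sum; apply: eq_bigr => e _; rewrite rmorphM.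
move=> <-; apply: eq_refl_diag => *; first by rewrite SX SY coefsXY.
by rewrite SX SY coefsYX.
Qed.

(** Specialization of u to -v. *)
Definition diag (F : fps (fps A)) : fps A :=
  fun r => \sum_(i < r.+1) sg (odd i) (F i (r - i)%N).
Fact diag_zmod_morphism : zmod_morphism diag.
Proof.
move=> F G; apply/funext => r; rewrite /diag coefsB -sumrB.
by apply: eq_bigr => i _; rewrite -sgB.
Qed.
HB.instance Definition _ :=
  GRing.isZmodMorphism.Build _ _ diag diag_zmod_morphism.

Lemma diagX F : diag (X F) = - shift (diag F).
Proof.
apply/funext => -[|r]; rewrite coefsN /diag /mulX big_ord_recl /= add0r.
  by rewrite big_ord0 oppr0.
rewrite -sumrN; apply: eq_bigr => i _.
by rewrite -[LHS]/(sg (~~ odd i) _) -addTb -sg_sg.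
Qed.

Lemma diagY F : diag (Y F) = shift (diag F).
Proof.
apply/funext => -[|r]; rewrite /diag /mulY big_ord_recr /= ?subnn sg0 addr0.
  by rewrite big_ord0.
by apply: eq_bigr => i _; rewrite subSn // -ltnS.
Qed.

Lemma diagXY f g : diag (inX A f * inY A g) = fps_negu f * g.
Proof.
apply/funext => r; rewrite /diag coefsM; apply: eq_bigr => i _.
by rewrite coefsXY /fps_negu /series_negu sgE signr_odd mulrA.
Qed.

Lemma diagYX f g : diag (inY A g * inX A f) = g * fps_negu f.
Proof.
apply/funext => r; rewrite /diag coefsM (reindex_inj rev_ord_inj).
apply: eq_bigr => i _; have ir : (i <= r)%N by rewrite -ltnS.
rewrite coefsYX /= subSS subKn // /fps_negu /series_negu.
by rewrite -sgMr sgE signr_odd.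
Qed.

(** At u = -v the factor u - v is 2u: the graded commutator of T(-u) and T(u)
    is again a difference of products, and these sum up to [S_symmetry]. *)
Lemma Tneg_rel a b c d :
  let k := par c && (par a (+) par b) (+) par a && par b in
  (Tpm true a b * Tpm false c d -
   sg ((par a (+) par b) && (par c (+) par d))
     (Tpm false c d * Tpm true a b)) *+ 2 =
  - shift (sg k (Tpm true c b * Tpm false a d - Tpm false c b * Tpm true a d)).
Proof.
move=> k; apply: shift_inj; rewrite mulr2n raddfD /= raddfN /=.
pose s := (par a (+) par b) && (par c (+) par d).
have := @Txy_rel false false false s k k a b c d erefl erefl erefl.
set p := _ - _; set q := sg k _ - _ => /(congr1 diag).
have -> : diag (Y p - X p) = shift (diag p) + shift (diag p).
  by rewrite raddfB /= diagX diagY opprK.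
rewrite diagX diagY /p /q -sgB !(raddf_sg diag, raddfB diag) /=.
rewrite !(diagXY, diagYX) => <-.
by [].
Qed.

(** The symmetry relation on the diagonal,
    S^(bar a)(bar a)(-u) = S^aa(u) + (S^aa(u) - S^aa(-u)) / 2u, where
    S^(bar a)(bar a)(-u) and S^aa(u) are sums of the same products in opposite
    orders. *)
Lemma S_symmetry a :
  (fps_negu (Sfps (bar a) (bar a)) - Sfps a a) *+ 2 =
  shift (Sfps a a - fps_negu (Sfps a a)).
Proof.
pose e c := tr_sign (bar c) (bar a).
pose D c := Tpm true (bar a) (bar c) * Tpm false a c -
  sg (par a (+) par c) (Tpm false a c * Tpm true (bar a) (bar c)).
pose D' c := Tpm true a (bar c) * Tpm false (bar a) c -
  Tpm false a (bar c) * Tpm true (bar a) c.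
have DD' c : sg (e c) (D c) *+ 2 = - shift (sg (e c (+) par a) (D' c)).
  rewrite -[LHS]/(sg (e c) (D c) + sg (e c) (D c)) -sgD.
  have := Tneg_rel (bar a) (bar c) a c; rewrite !par_bar => E.
  have -> : D c + D c = - shift (sg (par a) (D' c)).
    move: E; rewrite andbb.
    by have -> : par a && (par a (+) par c) (+) par a && par c = par a
      by parity_cases.
  by rewrite sgN -raddf_sg sg_sg.
have SD : \sum_c sg (e c) (D c) = fps_negu (Sfps (bar a) (bar a)) - Sfps a a.
  rewrite !SsE rmorph_sum [in RHS](reindex_inj (inv_inj (@barK M n))) /= -sumrB.
  apply: eq_bigr => c _.
  rewrite rmorphM /= /Tt (raddf_sg (@fps_negu A)) !sgMr /= !barK fps_neguK.
  rewrite sgB sg_sg; congr (_ - _); apply: eq_sg.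
  by rewrite /e /tr_sign !(odd_theta_bar, par_bar); parity_cases.
have SD' : \sum_c sg (e c (+) par a) (D' c) = fps_negu (Sfps a a) - Sfps a a.
  rewrite !SsE rmorph_sum -sumrB [in RHS](reindex_inj (inv_inj (@barK M n))) /=.
  apply: eq_bigr => c _.
  rewrite rmorphM /= /Tt (raddf_sg (@fps_negu A)) !sgMr /= !barK fps_neguK.
  rewrite sgB; congr (_ - _); apply: eq_sg;
  by rewrite /e /tr_sign !(odd_theta_bar, par_bar); parity_cases.
rewrite -SD -opprB -SD' raddfN /= raddf_sum -sumrMnl -sumrN.
by apply: eq_bigr => c _; rewrite DD'.
Qed.

Lemma S_symmetry_coef a r :
  (sg (odd r.+1) (Sfps (bar a) (bar a) r.+1) - Sfps a a r.+1) *+ 2 =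
  Sfps a a r - sg (odd r) (Sfps a a r).
Proof.
have coefs_negu f i : fps_negu f i = sg (odd i) (f i) :> A.
  by rewrite sgE signr_odd.
rewrite mulr2n -!coefs_negu -!coefsB -coefsD -mulr2n S_symmetry.
by [].
Qed.

Lemma S1E a : Sfps a a 1%N = t a a 1%N - t (bar a) (bar a) 1%N.
Proof.
have E c : (Tpm false a c * Tt c a) 1%N = sg (tr_sign c a)
    (t a c 1%N * (bar a == bar c)%:R - (a == c)%:R * t (bar a) (bar c) 1%N).
  have coefsM1 (f g : fps A) : (f * g) 1%N = f 0%N * g 1%N + f 1%N * g 0%N.
    by rewrite coefsM !big_ord_recl big_ord0 addr0.
  rewrite /Tt sgMr coefs_sg coefsM1 !coefs_Tpm /= !t0.
  by rewrite [sg true _]/(- _) mulrN addrC.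
rewrite SsE coefs_sum (bigD1 a) //= big1 => [|c cNa].
  rewrite addr0 [LHS]E /tr_sign andbN addFb addbb !eqxx mulr1 mul1r //.
rewrite [LHS]E (inj_eq (inv_inj (@barK M n))) eq_sym (negPf cNa).
by rewrite mulr0 mul0r subrr sg0.
Qed.

End YangianSeries.

Section Weights.
Variables (K : fieldType) (A : algType K) (M n : nat).
Local Notation idx := (idx M n).
Variable t : idx -> idx -> nat -> A.
Hypothesis t0 : forall a b, t a b 0%N = (a == b)%:R.
Hypothesis trel : forall a b c d r s, yangian_rel t a b c d r s = 0.
Variable wt : idx -> K.
Hypothesis wt_bar : forall a, wt (bar a) = - wt a.

(** For weights that are odd under [bar], this element of the twisted algebra is
    twice the corresponding element built from T ([cartan_S]), hence acts
    diagonally on the generators T. *)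
Definition cartan (s : idx -> idx -> nat -> A) : A :=
  \sum_a wt a *: sg (par a) (s a a 1%N).

Definition ad_eigen (h x : A) (k : K) := h * x - x * h = k *: x.

Lemma ad_eigenM h x y k l :
  ad_eigen h x k -> ad_eigen h y l -> ad_eigen h (x * y) (k + l).
Proof.
rewrite /ad_eigen => hx hy; rewrite scalerDl scalerAl -hx scalerAr -hy.
by rewrite mulrBl mulrBr !mulrA addrA subrK.
Qed.

Lemma ad_eigen_sum h (I : Type) (r : seq I) (F : I -> A) k :
  (forall i, ad_eigen h (F i) k) -> ad_eigen h (\sum_(i <- r) F i) k.
Proof.
move=> hF; rewrite /ad_eigen mulr_sumr mulr_suml -sumrB scaler_sumr.
by apply: eq_bigr => i _; apply: hF.
Qed.

Lemma ad_eigen_sg h x k b : ad_eigen h x k -> ad_eigen h (sg b x) k.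
Proof.
by rewrite /ad_eigen sgMr sgMl -sgB => ->; case: b => //; rewrite [RHS]scalerN.
Qed.

Lemma weight_T c d r : ad_eigen (cartan t) (t c d r) (wt c - wt d).
Proof.
rewrite /ad_eigen /cartan mulr_suml mulr_sumr -sumrB.
have E a : wt a *: sg (par a) (t a a 1%N) * t c d r -
    t c d r * (wt a *: sg (par a) (t a a 1%N)) =
    wt a *: ((c == a)%:R * t a d r - t c a r * (a == d)%:R).
  rewrite -scalerAl -scalerAr -scalerBr sgMl sgMr -sgB; congr (_ *: _).
  have := Tbr_rel trel a a c d 0 r.
  rewrite (Tbr0l t0) subr0 /Tbr addbb !t0.
  move=> ->; rewrite sg_sg andbF addFb andbb addbb //.
rewrite (eq_bigr _ (fun a _ => E a)).
under eq_bigr do rewrite scalerBr.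
rewrite sumrB scalerBl; congr (_ - _).
  rewrite (bigD1 c) //= eqxx mul1r big1 ?addr0 // => a.
  by rewrite eq_sym => /negPf->; rewrite mul0r scaler0.
rewrite (bigD1 d) //= eqxx mulr1 big1 ?addr0 // => a.
by move=> /negPf->; rewrite mulr0 scaler0.
Qed.

Lemma cartan_S : cartan (Sseries t) = cartan t *+ 2.
Proof.
rewrite mulr2n [X in _ + X](reindex_inj (inv_inj (@barK M n))) -big_split /=.
apply: eq_bigr => a _; rewrite par_bar wt_bar scaleNr -scalerBr -sgB.
by rewrite -(S1E t0).
Qed.

(** S^ab is a sum of T^ac T^(bar b)(bar c), and the contributions of c and bar c
    cancel. *)
Lemma weight_S a b r :
  ad_eigen (cartan (Sseries t)) (Sseries t a b r) ((wt a - wt b) *+ 2).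
Proof.
have wT c d k : ad_eigen (cartan (Sseries t)) (t c d k) ((wt c - wt d) *+ 2).
  have := weight_T c d k; rewrite /ad_eigen cartan_S mulrnAl mulrnAr -mulrnBl.
  by move=> ->; rewrite scalerMnl.
rewrite -[Sseries t a b r]/(Sfps t a b r) SsE coefs_sum; apply: ad_eigen_sum => c.
rewrite /Tt sgMr coefs_sg; apply: ad_eigen_sg; rewrite coefsM.
apply: ad_eigen_sum => k; rewrite !coefs_Tpm.
have -> : (wt a - wt b) *+ 2 =
    (wt a - wt c) *+ 2 + (wt (bar b) - wt (bar c)) *+ 2.
  by rewrite !wt_bar opprK -mulrnDl addrACA addNr addr0 // [X in _ + X]addrC.
by apply: ad_eigenM; [apply: wT | apply/ad_eigen_sg/wT].
Qed.
End Weights.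

(** * Eigenvectors *)

Section Eigenvectors.
Variables (K : fieldType) (V : vectType K).
Implicit Types (U : {vspace V}) (f : 'End(V)).

Definition restr_mx U f : 'M[K]_(\dim U) :=
  \matrix_(i, j) coord (vbasis U) j (f (vbasis U)`_i).

Lemma restr_mxP U f (c : 'rV_(\dim U)) : (f @: U <= U)%VS ->
  f (\sum_i c 0 i *: (vbasis U)`_i) =
  \sum_i (c *m restr_mx U f) 0 i *: (vbasis U)`_i.
Proof.
move=> fU; rewrite linear_sum.
under eq_bigr => i _.
  have fiU : f (vbasis U)`_i \in U.
    apply: (subvP fU); apply: memv_img; apply: vbasis_mem.
    by rewrite mem_nth // size_tuple.
  rewrite linearZ /= {1}(coord_vbasis fiU) scaler_sumr; over.
rewrite exchange_big; apply: eq_bigr => j _; rewrite !mxE scaler_suml.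
by apply: eq_bigr => i _; rewrite mxE scalerA.
Qed.

Lemma vbasis_sum_inj U (c d : 'rV_(\dim U)) :
  \sum_i c 0 i *: (vbasis U)`_i = \sum_i d 0 i *: (vbasis U)`_i -> c = d.
Proof.
move=> E; apply/rowP => j.
have fU : free (vbasis U) by apply: basis_free (vbasisP U).
by rewrite -(coord_sum_free (c 0) j fU) E coord_sum_free.
Qed.

Lemma eigenvalue_restr_mx U f l : (f @: U <= U)%VS ->
  eigenvalue (restr_mx U f) l <->
  exists v, [/\ v \in U, v != 0 & f v = l *: v].
Proof.
move=> fU; split.
  case/eigenvalueP => c cE c0; exists (\sum_i c 0 i *: (vbasis U)`_i); split.
  - apply: memv_suml => i _; apply/memvZ/vbasis_mem.
    by rewrite mem_nth // size_tuple.
  - apply: contraNneq c0 => E; apply/eqP/vbasis_sum_inj; rewrite E.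
    by rewrite big1 // => i _; rewrite mxE scale0r.
  - rewrite restr_mxP // cE scaler_sumr; apply: eq_bigr => i _.
    by rewrite mxE scalerA.
case=> v [vU v0 fv]; apply/eigenvalueP.
pose c : 'rV_(\dim U) := \row_i coord (vbasis U) i v.
have vE : v = \sum_i c 0 i *: (vbasis U)`_i.
  by rewrite {1}(coord_vbasis vU); apply: eq_bigr => i _; rewrite mxE.
exists c; last first.
  apply: contraNneq v0 => c0; rewrite vE c0 big1 // => i _.
  by rewrite mxE scale0r.
apply: vbasis_sum_inj; rewrite -restr_mxP // -vE fv {1}vE scaler_sumr.
by apply: eq_bigr => i _; rewrite !mxE scalerA.
Qed.
End Eigenvectors.

Section ClosedField.
Variables (K : closedFieldType) (V : vectType K).
Implicit Types (U : {vspace V}) (f : 'End(V)).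

Lemma eigenvector_exists U f : U != 0%VS -> (f @: U <= U)%VS ->
  exists l v, [/\ v \in U, v != 0 & f v = l *: v].
Proof.
move=> U0 fU; have [|l] := @closed_rootP K (char_poly (restr_mx U f)) _.
  by rewrite size_char_poly eqSS -dimv_eq0 in U0 *.
rewrite -eigenvalue_root_char => /(eigenvalue_restr_mx _ fU) [v vP].
by exists l, v.
Qed.

(** A stable nonzero subspace of minimal dimension consists of common
    eigenvectors: an eigenspace of one of the operators in it is again stable.
    The family may be infinite, and commutation is only required on [U]. *)
Lemma simultaneous_eigenvector (I : Type) (f : I -> 'End(V)) U : U != 0%VS ->
  (forall i, (f i @: U <= U)%VS) ->
  (forall i j v, v \in U -> f i (f j v) = f j (f i v)) ->
  exists v, [/\ v \in U, v != 0 & forall i, exists l, f i v = l *: v].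
Proof.
have [d] := ubnP (\dim U); elim: d U => // d IHd U dimU U0 fU fC.
have [fs|] := pselect (forall i, exists l, forall v, v \in U -> f i v = l *: v).
  exists (vpick U); split; [exact: memv_pick | by rewrite vpick0 |].
  by move=> i; have [l lE] := fs i; exists l; apply/lE/memv_pick.
move=> /existsNP[i fi]; have [l [v [vU v0 fv]]] := eigenvector_exists U0 (fU i).
pose U' := (U :&: lker (f i - l *: \1%VF))%VS.
have U'P w : (w \in U') = (w \in U) && (f i w == l *: w).
  by rewrite memv_cap memv_ker add_lfunE opp_lfunE scale_lfunE id_lfunE subr_eq0.
have [||j|j k w|w []] := IHd U'.
- rewrite (leq_trans _ (dimU : (\dim U <= d)%N)) //.
  have U'U : (U' <= U)%VS by apply: capvSl.
  rewrite ltn_neqAle dimvS // andbT; apply/negP => /eqP dimE; apply: fi.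
  exists l => w wU; apply/eqP.
  have : w \in U' by have /eqP-> : U' == U by rewrite eqEdim U'U dimE leqnn.
  by rewrite U'P wU.
- by apply: contraNneq v0 => E; rewrite -memv0 -E U'P vU fv eqxx.
- apply/subvP => _ /memv_imgP[w + ->]; rewrite !U'P => /andP[wU /eqP wE].
  rewrite (subvP (fU j)) ?memv_img //= fC // wE linearZ //.
- by rewrite U'P => /andP[wU _]; apply: fC.
by rewrite U'P => /andP[wU _] w0 wE; exists w.
Qed.
End ClosedField.

Section TopEigenvalue.
Variables (R : rcfType) (V : vectType (complex R)).
Import Order.TTheory Num.Theory.

Lemma max_Re (s : seq (complex R)) : s != [::] ->
  exists2 x, x \in s & forall y, y \in s -> complex.Re y <= complex.Re x.
Proof.
elim: s => // x s IHs _; have [->|/IHs[y ys yP]] := eqVneq s [::].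
  by exists x; rewrite ?mem_head // => y; rewrite inE => /eqP->.
have [xy|yx] := leP (complex.Re x) (complex.Re y).
  exists y; first by rewrite inE ys orbT.
  by move=> z; rewrite inE => /predU1P[->//|/yP].
exists x; first by rewrite mem_head.
by move=> z; rewrite inE => /predU1P[->//|/yP/le_trans]; apply; apply: ltW.
Qed.

(** There are finitely many eigenvalues; one with maximal real part is not
    raised by a positive integer. *)
Lemma top_eigenvalue (h : 'End(V)) : (fullv : {vspace V}) != 0%VS ->
  exists l, (exists2 v, v != 0 & h v = l *: v) /\
    forall k v, (0 < k)%N -> h v = (l + k%:R) *: v -> v = 0.
Proof.
move=> V0; pose A := restr_mx fullv h.
have hV : (h @: fullv <= fullv)%VS by apply: subvf.
have [s sE] := closed_field_poly_normal (char_poly A).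
have rootE x : (x \in s) = eigenvalue A x.
  rewrite eigenvalue_root_char sE rootZ ?root_prod_XsubC //.
  by rewrite lead_coef_eq0 -size_poly_eq0 size_char_poly.
have s0 : s != [::].
  have [l [v [vV v0 hv]]] := eigenvector_exists V0 hV.
  have : l \in s by rewrite rootE; apply/(eigenvalue_restr_mx _ hV); exists v.
  by case: (s).
have [l ls lP] := max_Re s0; exists l; split.
  move: ls; rewrite rootE => /(eigenvalue_restr_mx _ hV)[v [_ v0 hv]].
  by exists v.
move=> k v k0 hv; apply/eqP/negPn/negP => v0.
have /lP : l + k%:R \in s.
  by rewrite rootE; apply/(eigenvalue_restr_mx _ hV); exists v; rewrite memvf.
by rewrite raddfD raddfMn /= gerDl pmulrn_lle0 // ler10.
Qed.
End TopEigenvalue.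

(** * Passage to the twisted super-Yangian and its truncations *)

Section QuotientMorphism.
Variables (K : fieldType) (A : algType K) (G : A -> Prop).
Variable G_proper : ~ in_ideal G 1.

Fact qproj_zmod_morphism : zmod_morphism (qproj G_proper).
Proof. exact: qprojB. Qed.
Fact qproj_monoid_morphism : monoid_morphism (qproj G_proper).
Proof. by split => // x y; apply: qprojM. Qed.
HB.instance Definition _ :=
  GRing.isZmodMorphism.Build _ _ (qproj G_proper) qproj_zmod_morphism.
HB.instance Definition _ :=
  GRing.isMonoidMorphism.Build _ _ (qproj G_proper) qproj_monoid_morphism.

Lemma qproj_gen x : G x -> qproj G_proper x = 0.
Proof.
move=> Gx; rewrite -(qproj0 G_proper); apply/qproj_eq; rewrite subr0.
exact/asboolP/ideal_gen.
Qed.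
End QuotientMorphism.

Lemma rmorph_yangian_rel (A A' : pzRingType) (f : {rmorphism A -> A'}) M n
    (t : idx M n -> idx M n -> nat -> A) a b c d r s :
  f (yangian_rel t a b c d r s) =
  yangian_rel (fun a b r => f (t a b r)) a b c d r s.
Proof.
rewrite /yangian_rel /gcomm.
by rewrite !(rmorphB, rmorphM, rmorphXn, rmorphN1).
Qed.

Section TwistedRelations.
Variables (K : fieldType) (M n : nat).
Local Notation S := (@Stw K M n).

Lemma Tcoef0 a b : @Tcoef K M n a b 0 = (a == b)%:R.
Proof. exact: rmorph_nat. Qed.

Lemma Tcoef_rel a b c d r s : yangian_rel (@Tcoef K M n) a b c d r s = 0.
Proof.
rewrite -(rmorph_yangian_rel (qproj (@yangian_proper K M n))).
by apply: qproj_gen; exists a, b, c, d, r, s.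
Qed.

Definition tval : {rmorphism twistedYangian K M n -> superYangian K M n} :=
  (\val : subAlg (@Sgens K M n) -> superYangian K M n).

Lemma tval_inj : injective tval. Proof. exact: val_inj. Qed.
Lemma tvalZ k x : tval (k *: x) = k *: tval x. Proof. by []. Qed.

Lemma Stw_reflection a c :
  refl_diag (fun a b c d i j => S a b i * S c d j)
            (fun a b c d i j => S a b j * S c d i) a c = 0.
Proof.
have E : map2 tval (refl_diag (fun a b c d i j => S a b i * S c d j)
            (fun a b c d i j => S a b j * S c d i) a c) = 0.
  rewrite map2_refl_diag -(S_reflection Tcoef0 Tcoef_rel a c).
  congr refl_diag; do 6!apply/funext => ?; exact: rmorphM.
apply/funext => i; apply/funext => j; apply: tval_inj.
have Eij := congr1 (fun F : fps (fps (superYangian K M n)) => F i j) E.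
exact: etrans Eij (esym (rmorph0 tval)).
Qed.

Lemma Stw_symmetry a r :
  (sg (odd r.+1) (S (bar a) (bar a) r.+1) - S a a r.+1) *+ 2 =
  S a a r - sg (odd r) (S a a r).
Proof.
have tsg b x : sg b (tval x) = tval (sg b x) by rewrite (raddf_sg tval).
apply: tval_inj.
transitivity ((sg (odd r.+1) (tval (S (bar a) (bar a) r.+1))
  - tval (S a a r.+1)) *+ 2); first by rewrite tsg -(rmorphB tval) (rmorphMn tval).
transitivity (tval (S a a r) - sg (odd r) (tval (S a a r))); last first.
  by rewrite tsg -(rmorphB tval).
exact: (S_symmetry_coef Tcoef0 Tcoef_rel).
Qed.

Lemma Stw_weight (wt : idx M n -> K) : (forall a, wt (bar a) = - wt a) ->
  forall a b r,
  ad_eigen (cartan wt S) (S a b r) ((wt a - wt b) *+ 2).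
Proof.
move=> wtN a b r; apply: tval_inj; rewrite rmorphB !rmorphM tvalZ.
have -> : tval (cartan wt S) = cartan wt (@Sser K M n).
  rewrite rmorph_sum; apply: eq_bigr => c _.
  by rewrite tvalZ (raddf_sg tval).
exact: (weight_S Tcoef0 Tcoef_rel wtN).
Qed.
End TwistedRelations.

(** * The weights *)

Section Weight.
Variables M n : nat.
Implicit Types a b : idx M n.

(** The indices in decreasing order for [Phi_plus] are M+1..M+n, then 1..M, then
    M+n+1..M+2n; the weights decrease by steps of 2 along this list and are
    symmetric about 0, so that the raising eigenvalues are positive integers. *)
Definition weight a : int :=
  if (pos a <= M)%N then (M + 1)%N%:Z - (2 * pos a)%N%:Z
  else if (pos a <= M + n)%N then (3 * M + 2 * n + 1)%N%:Z - (2 * pos a)%N%:Z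
  else (M + 2 * n + 1)%N%:Z - (2 * pos a)%N%:Z.

Local Ltac weight_lia :=
  repeat match goal with |- context [if ?b then _ else _] =>
    let h := fresh in case: (boolP b) => h end; lia.

Lemma pos_bounds a : (0 < pos a <= M + 2 * n)%N.
Proof. by case: a. Qed.

Lemma weight_bar a : weight (bar a) = - weight a.
Proof.
rewrite /weight pos_bar; have := pos_bounds a; move: (pos a) => k kP.
by case: (leqP k M) => kM; [|case: (leqP k (M + n)) => kn]; weight_lia.
Qed.

Lemma weight_inj : injective weight.
Proof.
move=> a b; have := pos_bounds a; have := pos_bounds b => bP aP E.
apply: pos_inj; move: E; rewrite /weight; move: (pos a) (pos b) aP bP => k l kP lP.
weight_lia.
Qed.

Lemma Phi_plus_weight a b : Phi_plus a b -> weight b < weight a.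
Proof.
have := pos_bounds a; have := pos_bounds b; rewrite /weight /Phi_plus.
move: (pos a) (pos b) => k l lP kP /= P.
weight_lia.
Qed.

Lemma weight0_par a : weight a = 0 -> bar a = a /\ par a = false.
Proof.
move=> a0; split; first by apply: weight_inj; rewrite weight_bar a0.
have := pos_bounds a; move: a0; rewrite /weight /par; move: (pos a) => k E kP.
move: E; weight_lia.
Qed.
End Weight.

(** * Consequences of the diagonal reflection equation *)

Section Cancellation.
Variable Z : zmodType.
Implicit Types F G D L : fps (fps Z).
Local Notation X := (@mulX Z).
Local Notation Y := (@mulY Z).

(** Induction on the power of x: multiplication by y is injective, and the
    right-hand side only involves smaller powers. *)
Lemma mulY_eq_mulX F G : Y F = X G ->
  (forall i, F i = 0 -> G i = 0) -> F = 0.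
Proof.
move=> FG FG0; apply/funext => i; elim: i => [|i IHi]; apply: shift_inj.
  by rewrite [LHS](congr1 (fun H : fps (fps Z) => H 0%N) FG) raddf0.
by rewrite [LHS](congr1 (fun H : fps (fps Z) => H i.+1) FG) raddf0; apply: FG0.
Qed.

(** The factor R = (y - x) - xyP can be cancelled when P maps the series [L] to
    zero or, up to sign, to itself; [cancel_R'] does the same for R'. *)
Lemma cancel_R L L' e : Y L - X L - X (Y (sg e L')) = 0 ->
  L' = 0 \/ L' = L -> L = 0.
Proof.
move=> E L'L; apply: (@mulY_eq_mulX _ (L + Y (sg e L'))).
  by apply/eqP; rewrite raddfD -subr_eq0 opprD addrA E.
move=> i Li; have L'i : L' i = 0 by case: L'L => ->.
by rewrite coefsD Li /mulY coefs_sg L'i sg0 raddf0 add0r.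
Qed.

Lemma cancel_R' D D' : Y D + X D + X (Y D') = 0 -> D' = 0 \/ D' = D -> D = 0.
Proof.
move=> E D'D; apply: (@mulY_eq_mulX _ (- (D + Y D'))).
  by apply/eqP; rewrite raddfN raddfD /= -addr_eq0 addrA E.
move=> i Di; have D'i : D' i = 0 by case: D'D => ->.
by rewrite coefsN coefsD Di /mulY D'i raddf0 add0r oppr0.
Qed.

Lemma sub_R e e' F F' G G' :
  Y F - X F - X (Y (sg e F')) - (Y G - X G - X (Y (sg e' G'))) =
  Y (F - G) - X (F - G) - X (Y (sg e F' - sg e' G')).
Proof.
rewrite !(raddfB X, raddfB Y) /= opprD addrACA opprD [X in X + _]addrACA.
by rewrite -!opprD.
Qed.

Lemma sub_R' F F' G G' :
  Y F + X F + X (Y F') - (Y G + X G + X (Y G')) =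
  Y (F - G) + X (F - G) + X (Y (F' - G')).
Proof.
by rewrite !(raddfB X, raddfB Y) /= opprD addrACA opprD [X in X + _]addrACA.
Qed.

Section Diagonal.
Variables (M n : nat).
Local Notation idx := (idx M n).
Variables P Q : idx -> idx -> idx -> idx -> fps (fps Z).

Let G1 b d a c := sg ((par b (+) par a) && par d) (P b a d c).
Let H1 b d a c := sg ((par b (+) par d) && par d (+)
  (par d (+) odd_theta (bar d) (+) odd_theta a)) (P b (bar d) (bar a) c).
Let G2 b d a c := sg ((par a (+) par b) && par d) (Q c d a b).
Let H2 b d a c := sg ((par a (+) odd_theta a (+) odd_theta (bar d)) (+)
  (par d (+) par b) && par d) (Q c (bar a) (bar d) b).

Lemma refl_diagE a c : refl_diag P Q a c =
  let L := Y (G1 a c a c - G2 a c a c) + X (G1 a c a c - G2 a c a c)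
    + X (Y (H1 a c a c - H2 a c a c)) in
  let L' := Y (G1 c a a c - G2 c a a c) + X (G1 c a a c - G2 c a a c)
    + X (Y (H1 c a a c - H2 c a a c)) in
  Y L - X L - X (Y (sg (par a && par c) L')).
Proof. by rewrite /refl_diag sub_R -sgB /refl_lhs /refl_rhs !sub_R'. Qed.

Let X0 : X 0 = 0. Proof. exact: raddf0. Qed.
Let Y0 : Y 0 = 0. Proof. exact: raddf0. Qed.

(** The hypotheses kill all terms other than (y - x)(y + x) [S^aa(u), S^cc(v)]. *)
Lemma refl_diag_lt a c : refl_diag P Q a c = 0 ->
  (forall b d, P b d a c = 0) -> (forall b d, Q b d a c = 0) ->
  (forall b d, P b d (bar a) c = 0) -> (forall b d, Q b d (bar a) c = 0) ->
  (forall b d, Q b d (bar c) a = 0) ->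
  P a a c c = Q c c a a.
Proof.
move=> E wP wQ wP' wQ' wQ''.
have L'0 : G1 c a a c = 0 /\ G2 c a a c = 0 /\ H1 c a a c = 0 /\ H2 c a a c = 0.
  by rewrite /G1 /G2 /H1 /H2 wP wQ wP' wQ' !sg0.
have H0 : H1 a c a c = 0 /\ H2 a c a c = 0.
  by rewrite /H1 /H2 wP' wQ'' !sg0.
move: L'0 H0 E => [g1 [g2 [h1 h2]]] [H10 H20].
rewrite refl_diagE /= g1 g2 h1 h2 H10 H20 subr0 => E.
have L'0 : Y 0 + X 0 + X (Y 0) = 0 by rewrite !(X0, Y0, addr0).
have := cancel_R' (cancel_R E (or_introl L'0)) (or_introl erefl).
by rewrite /G1 /G2 !addbb => /eqP; rewrite subr_eq0 => /eqP.
Qed.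

(** Here the exchange terms of R survive and give
    ((y - x) - (-1)^par a xy)(y + x) [S^aa(u), S^aa(v)] = 0. *)
Lemma refl_diag_eq a : refl_diag P Q a a = 0 ->
  (forall b d, P b d (bar a) a = 0) -> (forall b d, Q b d (bar a) a = 0) ->
  P a a a a = Q a a a a.
Proof.
move=> E wP wQ; have H10 : H1 a a a a = 0 by rewrite /H1 wP sg0.
have H20 : H2 a a a a = 0 by rewrite /H2 wQ sg0.
move: E; rewrite refl_diagE /= H10 H20 subr0 => E.
have := cancel_R' (cancel_R E (or_intror erefl)) (or_introl erefl).
by rewrite /G1 /G2 !addbb => /eqP; rewrite subr_eq0 => /eqP.
Qed.

(** When [a = bar a] no factor is a raising operator, but every term is a
    multiple of the commutator:
    ((y - x) - xy)((y + x) + xy) [S^aa(u), S^aa(v)] = 0. *)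
Lemma refl_diag_mid a : refl_diag P Q a a = 0 -> bar a = a -> par a = false ->
  P a a a a = Q a a a a.
Proof.
move=> E aa par_a.
have H1E : H1 a a a a = P a a a a by rewrite /H1 aa par_a addFb !addbb.
have H2E : H2 a a a a = Q a a a a.
  by rewrite /H2 aa par_a addFb !addbb.
have G1E : G1 a a a a = P a a a a by rewrite /G1 par_a.
have G2E : G2 a a a a = Q a a a a by rewrite /G2 par_a.
move: E; rewrite refl_diagE /= H1E H2E G1E G2E => E.
apply/eqP; rewrite -subr_eq0; apply/eqP.
exact: cancel_R' (cancel_R E (or_intror erefl)) (or_intror erefl).
Qed.

End Diagonal.
End Cancellation.

(** * The action on a representation *)

Section Action.
Variables (K : fieldType) (M n p : nat) (V : vectType K) (rho : Wrep M n p V).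
Local Notation S := (@Stw K M n).
Implicit Types (v : V) (x y : twistedYangian K M n).

Definition act v x : V := rho (qproj (@trunc_proper K M n p) x) v.

Fact act_zmod_morphism v : zmod_morphism (act v).
Proof. by move=> x y; rewrite /act !raddfB add_lfunE opp_lfunE. Qed.
HB.instance Definition _ v :=
  GRing.isZmodMorphism.Build _ _ (act v) (act_zmod_morphism v).

Lemma actM v x y : act v (x * y) = act (act v y) x.
Proof. by rewrite /act rmorphM rep_actM comp_lfunE. Qed.

Lemma actZ v k x : act v (k *: x) = k *: act v x.
Proof.
have E : qproj (@trunc_proper K M n p) (k *: x) =
  k *: qproj (@trunc_proper K M n p) x by apply: qprojZ.
by rewrite /act E linearZ scale_lfunE.
Qed.

Lemma actZr v k x : act (k *: v) x = k *: act v x.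
Proof. exact: linearZ. Qed.

Lemma act_reflection v a c :
  refl_diag (fun a b c d i j => act (act v (S c d j)) (S a b i))
            (fun a b c d i j => act (act v (S c d i)) (S a b j)) a c = 0.
Proof.
have := congr1 (map2 (act v)) (@Stw_reflection K M n a c).
rewrite map2_refl_diag raddf0 => <-.
by apply: eq_refl_diag => *; rewrite -actM.
Qed.

Lemma act_symmetry v a r :
  (sg (odd r.+1) (act v (S (bar a) (bar a) r.+1)) - act v (S a a r.+1)) *+ 2 =
  act v (S a a r) - sg (odd r) (act v (S a a r)).
Proof.
rewrite -!(raddf_sg (act v)) -!(raddfB (act v)) -(raddfMn (act v)).
by rewrite Stw_symmetry.
Qed.

Section Highest.
Variable l : K.
Let wt (a : idx M n) : K := (weight a)%:~R.
Let h := cartan wt S.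
Hypothesis top : forall k v, (0 < k)%N -> act v h = (l + k%:R) *: v -> v = 0.
Variable v : V.
Hypothesis vl : act v h = l *: v.

Lemma act_weight a b r :
  act (act v (S a b r)) h = (l + (wt a - wt b) *+ 2) *: act v (S a b r).
Proof.
have wtN c : wt (bar c) = - wt c by rewrite /wt weight_bar rmorphN.
have /(congr1 (act v)) := Stw_weight wtN a b r.
rewrite raddfB /= !actM actZ vl actZr => /eqP.
by rewrite subr_eq => /eqP->; rewrite [RHS]scalerDl [RHS]addrC.
Qed.

(** Otherwise S^ab v would be an eigenvector of eigenvalue l + k, k > 0. *)
Lemma act_raising a b r : weight b < weight a -> act v (S a b r) = 0.
Proof.
move=> ba; apply: (top (k := `|weight a - weight b|%N * 2)); first by lia.
have E : wt a - wt b = `|weight a - weight b|%N%:R.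
  by rewrite pmulrn gez0_abs ?rmorphB //; lia.
by rewrite act_weight E mulrnA.
Qed.

Lemma act_diag a r : act (act v (S a a r)) h = l *: act v (S a a r).
Proof. by rewrite act_weight subrr mul0rn addr0. Qed.

Let P a b c d : fps (fps V) := fun i j => act (act v (S c d j)) (S a b i).
Let Q a b c d : fps (fps V) := fun i j => act (act v (S c d i)) (S a b j).

Lemma raisingP a b c d : weight d < weight c -> P a b c d = 0.
Proof.
move=> dc; do 2!apply/funext => ?; rewrite /P act_raising //.
exact: (linear0 (rho _)).
Qed.
Lemma raisingQ a b c d : weight d < weight c -> Q a b c d = 0.
Proof.
move=> dc; do 2!apply/funext => ?; rewrite /Q act_raising //.
exact: (linear0 (rho _)).
Qed.

(** The right factors that occur are S^ac, S^(bar a)c and S^(bar c)a; they raise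
    the weight since [weight c < weight a <= 0]. *)
Lemma act_comm_lt a c : weight c < weight a -> weight a <= 0 ->
  P a a c c = Q c c a a.
Proof.
move=> ca a0; apply: (refl_diag_lt (act_reflection v a c)) => b d.
- exact: raisingP.
- exact: raisingQ.
- by apply: raisingP; rewrite weight_bar; lia.
- by apply: raisingQ; rewrite weight_bar; lia.
- by apply: raisingQ; rewrite weight_bar; lia.
Qed.

Lemma act_comm_eq a : weight a <= 0 -> P a a a a = Q a a a a.
Proof.
have E := act_reflection v a a; have [a0 _|aN0 a_le0] := eqVneq (weight a) 0.
  have [aa par_a] := weight0_par a0; exact: refl_diag_mid E aa par_a.
apply: (refl_diag_eq E) => b d.
- by apply: raisingP; rewrite weight_bar; lia.
- by apply: raisingQ; rewrite weight_bar; lia.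
Qed.

Lemma act_comm a c i j : weight a <= 0 -> weight c <= 0 ->
  act (act v (S c c j)) (S a a i) = act (act v (S a a i)) (S c c j).
Proof.
move=> a0 c0; have [ca|ac] := boolP (weight c < weight a).
  by have := congr1 (fun F : fps (fps V) => F i j) (act_comm_lt ca a0).
have [ac'|ca] := boolP (weight a < weight c).
  exact: esym (f_equal (fun F : fps (fps V) => F j i) (act_comm_lt ac' c0)).
have -> : c = a by apply: weight_inj; lia.
by have := congr1 (fun F : fps (fps V) => F i j) (act_comm_eq a0).
Qed.

End Highest.
End Action.

(** Solves the symmetry relation for the generator of the opposite index. *)
Lemma scalar_of_double (K : fieldType) (V : lmodType K) (v x y z : V) b b' :
  (2 : K) != 0 -> (sg b x - y) *+ 2 = z - sg b' z ->
  (exists l, y = l *: v) -> (exists l, z = l *: v) -> exists l, x = l *: v.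
Proof.
move=> two0 E [ly yl] [lz zl].
have sgZ c (w : V) : sg c w = (-1) ^+ c *: w.
  by case: c; rewrite ?scaleN1r ?scale1r.
exists ((-1) ^+ b * (ly + 2^-1 * (lz - (-1) ^+ b' * lz))).
rewrite -scalerA -sgZ; have <- : sg b x = (ly + 2^-1 * (lz - (-1) ^+ b' * lz)) *: v.
  rewrite scalerDl -yl -scalerA scalerBl -scalerA -zl -sgZ -E -scaler_nat.
  by rewrite scalerA mulVf // scale1r addrC subrK.
by rewrite sg_sg addbb.
Qed.

Section Final.
Variables (R : realType) (M n p : nat) (V : vectType (complex R)).
Variable rho : Wrep M n p V.
Local Notation K := (complex R).
Local Notation S := (@Stw K M n).

Lemma nonzero_highest_weight : (fullv : {vspace V}) != 0%VS ->
  is_highest_weight rho.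
Proof.
move=> V0; pose h : twistedYangian K M n := cartan (fun a => (weight a)%:~R) S.
pose op (x : twistedYangian K M n) : 'End(V) :=
  rho (qproj (@trunc_proper K M n p) x).
have [l [[v0 v0N0 v0l] top]] := top_eigenvalue (op h) V0.
pose U := lker (op h - l *: \1%VF).
have UP v : (v \in U) = (act rho v h == l *: v).
  by rewrite memv_ker add_lfunE opp_lfunE scale_lfunE id_lfunE subr_eq0.
(* Only the indices of nonpositive weight are diagonalized; the zero operators
   keep the family total. *)
pose f (ar : idx M n * nat) : 'End(V) :=
  if weight ar.1 <= 0 then op (S ar.1 ar.1 ar.2) else 0.
have [|ar|ar cs v|v [vU vN0 vf]] := @simultaneous_eigenvector K V _ f U.
- apply: contraNneq v0N0 => E; rewrite -memv0 -E UP; exact/eqP.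
- apply/subvP => _ /memv_imgP[v + ->]; rewrite /f; case: ifP => _; last first.
    by rewrite zero_lfunE mem0v.
  rewrite !UP => /eqP vl; apply/eqP; exact: act_diag vl _ _.
- rewrite UP => /eqP vl; have f0 ar' : ~~ (weight ar'.1 <= 0) -> f ar' = 0.
    by rewrite /f => /negPf->.
  have fE ar' : weight ar'.1 <= 0 -> f ar' = op (S ar'.1 ar'.1 ar'.2).
    by rewrite /f => ->.
  have [a0|/f0->] := boolP (weight ar.1 <= 0); last first.
    by rewrite !zero_lfunE linear0.
  have [c0|/f0->] := boolP (weight cs.1 <= 0); last first.
    by rewrite !zero_lfunE linear0.
  rewrite (fE _ a0) (fE _ c0).
  exact: (act_comm top vl ar.2 cs.2 a0 c0).
have /eqP vl : act rho v h == l *: v by rewrite -UP.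
exists v; split=> //.
  move=> a b r /Phi_plus_weight ab _; exact: (act_raising top vl r ab).
have low a : weight a <= 0 -> forall r, exists l, act rho v (S a a r) = l *: v.
  by move=> a0 r; have := vf (a, r); rewrite /f a0.
move=> a [//|r] _; have [/low/(_ r.+1)//|a0] := boolP (weight a <= 0).
(* A positive weight: use the symmetry relation for bar a. *)
have low' := low (bar a) _; rewrite weight_bar in low'.
have := act_symmetry rho v (bar a) r; rewrite barK => E.
have two0 : (2 : K) != 0 by rewrite Num.Theory.pnatr_eq0.
by apply: (scalar_of_double two0 E); apply: low'; lia.
Qed.
End Final.

Theorem theorem7p2 (R : realType) (M n p : nat)
    (hM : (1 <= M)%N) (hn : (1 <= n)%N) (hp : (1 <= p)%N)
    (V : vectType (complex R)) (rho : Wrep M n p V) :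
  irreducible_rep rho -> is_highest_weight rho.
Proof. by case=> /eqP V0 _; apply: nonzero_highest_weight. Qed.
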